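(* Let $K$ and $V$ be closed convex bodies in $\mathbb{R}^m$ that are centrally symmetric with respect to the origin, and let $\mathbf{a}\in\partial(V)$ be a point satisfying $\|\mathbf{a}\|_K=M(K,V)$. For every $f\in B_V\cap C(\mathbb{R}^m)$, $x\in\mathbb{R}^m$, $y\in\partial(K^* )$, and $\alpha\in[0,2\pi)$, the following inequality holds: $$\left|\sin\alpha\,(\nabla f(x),y)-M(K,V)\cos\alpha\, f(x)\right|\le M(K,V)\,\|f\|_{C(\mathbb{R}^m)}.\qquad( * )$$ There exist $x=x_0\in\mathbb{R}^m$ and $y=y_0\in\partial(K^* )$ such that for any $\alpha\in[0,2\pi)$ and the functions $$f(x)=f_0(x):=C_1e^{i(\mathbf{a},x)}+C_2e^{-i(\mathbf{a},x)},\qquad C_1\in\mathbb{C},\quad C_2\in\mathbb{C},$$ with $\|f_0\|_{C(\mathbb{R}^m)}=\left(|C_1|^2+|C_2|^2\right)^{1/2}$, equality holds in $( * )$. Hence inequality $( * )$ is sharp.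
   Context: $(t,y)=\sum_{j=1}^m t_jy_j$; for a differentiable $f:\mathbb{R}^m\to\mathbb{C}$, $\nabla f(x)=(\partial f(x)/\partial x_1,\ldots,\partial f(x)/\partial x_m)$ and $(\nabla f(x),y)=\sum_{j=1}^m y_j\,\partial f(x)/\partial x_j$. A convex body is a compact convex set with non-empty interior; $\partial(V)$ is the boundary of $V$. For an origin-symmetric convex body $V$, its polar is $V^*=\{y\in\mathbb{R}^m: |(t,y)|\le 1 \text{ for all } t\in V\}$ (and $V^{**}=V$). Norms: $\|x\|_V:=\max_{t\in V^*}|(t,x)|$ on $\mathbb{R}^m$ (unit ball $V$), and $\|z\|_{V^*}:=\max_{t\in V}|\sum_{j=1}^m t_jz_j|$ for $z\in\mathbb{C}^m$; likewise for $K$. Define $M(K,V):=\max_{y\in V}\|y\|_K=\max_{y\in\partial(V)}\|y\|_K$. $C(\mathbb{R}^m)$ is the space of continuous complex-valued functions $F$ on $\mathbb{R}^m$ with finite norm $\|F\|_{C(\mathbb{R}^m)}=\sup_{x\in\mathbb{R}^m}|F(x)|$. $B_V$ is the set of entire functions $f:\mathbb{C}^m\to\mathbb{C}$ of exponential type $V$, i.e. such that for every $\varepsilon>0$ there is a constant $C_0(\varepsilon,f)>0$ with $|f(z)|\le C_0(\varepsilon,f)\exp[(1+\varepsilon)\|z\|_{V^*}]$ for all $z\in\mathbb{C}^m$. The same notation is used for $f\in B_V$ and its restriction to $\mathbb{R}^m$.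
   Formalization: The formula for the norm of f_0 is taken as a condition on C_1, C_2, not a fact for all of them: the norm is |C_1|+|C_2| (for C_1=C_2=1 it is 2, not √2), so equality at fixed x_0, y_0 for all α is claimed only when C_1=0 or C_2=0; for other C_1, C_2 it fails. *)

(* Defs.v *)
From HB Require Import structures.
From mathcomp Require Import all_boot all_order all_algebra.
From mathcomp Require Import all_classical all_reals all_analysis.
From mathcomp Require Import complex.
Set Implicit Arguments.
Unset Strict Implicit.
Unset Printing Implicit Defensive.
Import Order.TTheory GRing.Theory Num.Theory.
Import numFieldNormedType.Exports.
Local Open Scope classical_set_scope.
Local Open Scope ring_scope.
Local Open Scope complex_scope.

(* R[i] bundled as a [numClosedFieldType], so that it and the row vectors over
   it inherit the topology and norm of numeric fields; [differentiable] between
   such spaces is complex (Frechet) differentiability. *)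
Definition Cplx (R : realType) : numClosedFieldType := R[i].

(* [`|z|] on [R[i]] has values in [R[i]]; this is the same modulus in [R]. *)
Definition modulus (R : realType) (z : Cplx R) : R := ComplexField.Normc.normc z.

Definition cexp (R : realType) (z : Cplx R) : Cplx R :=
  let: a +i* b := z in (expR a * cos b) +i* (expR a * sin b).

Section BernsteinSzego.
Context {R : realType} {m : nat}.
Implicit Types (K V : set 'rV[R]_m) (t x y : 'rV[R]_m) (z : 'rV[Cplx R]_m).
Implicit Types (f : 'rV[Cplx R]_m -> Cplx R) (F : 'rV[R]_m -> Cplx R).

Definition dotr t y : R := \sum_j t 0 j * y 0 j.

(* Bilinear, not Hermitian. *)
Definition dotc t z : Cplx R := \sum_j ((t 0 j)%:C : Cplx R) * z 0 j.

Definition boundary V : set 'rV[R]_m := closure V `\` V°.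

Definition convex_body V : Prop :=
  [/\ compact V, convex_set V & V° !=set0].

Definition origin_symmetric V : Prop := forall x, V x -> V (- x).

Definition polar V : set 'rV[R]_m :=
  [set y | forall t, V t -> `|dotr t y| <= 1].

(* The suprema below are maxima when the sets are convex bodies; [sup] is 0 on
   a set of reals that is empty or unbounded above. *)
Definition body_norm V x : R := sup [set `|dotr t x| | t in polar V].

Definition polar_norm V z : R := sup [set modulus (dotc t z) | t in V].

Definition maxnorm K V : R := sup [set body_norm K y | y in V].

Definition entire f : Prop := forall z, differentiable f z.

Definition exp_type V f : Prop :=
  entire f /\
  forall e : R, 0 < e -> exists2 C0 : R, 0 < C0 &
    forall z, modulus (f z) <= C0 * expR ((1 + e) * polar_norm V z).

Definition restr f : 'rV[R]_m -> Cplx R :=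
  fun x => f (map_mx (real_complex R) x).

Definition bounded_continuous F : Prop :=
  continuous F /\ has_ubound (range (fun x => modulus (F x))).

Definition supnorm F : R := sup (range (fun x => modulus (F x))).

(* Derivative of a complex-valued function of real variables, taken on the real
   and imaginary parts. *)
Definition partial F x (j : 'I_m) : Cplx R :=
  'D_(delta_mx 0 j) (fun u => complex.Re (F u)) x +i*
  'D_(delta_mx 0 j) (fun u => complex.Im (F u)) x.

Definition grad_pair F x y : Cplx R := \sum_j ((y 0 j)%:C : Cplx R) * partial F x j.

Definition BS_lhs K V F x y (alpha : R) : R :=
  modulus (((sin alpha)%:C : Cplx R) * grad_pair F x y
           - ((maxnorm K V * cos alpha)%:C : Cplx R) * F x).

(* C1 exp(i(a,z)) + C2 exp(-i(a,z)) on C^m. *)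
Definition extremal a (C1 C2 : Cplx R) : 'rV[Cplx R]_m -> Cplx R :=
  let iC : Cplx R := 0 +i* 1 in
  fun z => C1 * cexp (iC * dotc a z) + C2 * cexp (- (iC * dotc a z)).

End BernsteinSzego.

(* Main.v *)
Require Import Defs.
From HB Require Import structures.
From mathcomp Require Import all_boot all_order all_algebra.
From mathcomp Require Import all_classical all_reals all_analysis.
From mathcomp Require Import complex ring lra.
Set Implicit Arguments.
Unset Strict Implicit.
Unset Printing Implicit Defensive.
Import Order.TTheory GRing.Theory Num.Theory.
Import numFieldNormedType.Exports.
Local Open Scope classical_set_scope.
Local Open Scope ring_scope.

(** Let y belong to the polar of K and put g(s) = f(x + s y), an entire function
    of one complex variable. For t in V one has |(t,y)| <= ||t||_K <= M(K,V), so
    g has exponential type M = M(K,V); on the real line it is bounded by the norm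
    S of f, and g'(0) is the pairing of the gradient of f at x with y. The
    inequality is therefore the Bernstein-Szego inequality on the line
    (bernstein_szego_line), applied to g (bernstein_szego_bodies).

    The inequality on the line is obtained by comparing g with an exponential.
    Phragmen-Lindelof gives |g(z)| <= S exp(M |Im z|). For |lam| > S the function
    Phi(z) = lam exp(- i M z) - g(z) then has no zero in the closed upper
    half-plane, and the quotient of the conjugate of Phi(conj z) by Phi(z) is
    bounded there and unimodular on the real line. Hence |Phi(conj z)| <= |Phi(z)|
    for Im z >= 0 (comparison_reflect), and differentiating along the imaginary
    axis at 0 yields a sign condition on Phi(0) and Phi'(0). In terms of p and q
    defined by g(0) = p + q and i g'(0) = M (p - q), it says |lam - p| >= |q|. As
    lam is arbitrary outside the disc of radius S, |p| + |q| <= S. Finally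
    sin alpha g'(0) - M cos alpha g(0) is - M (exp(i alpha) p + exp(- i alpha) q),
    whose modulus is at most M (|p| + |q|) <= M S.

    The function theory rests on complex differentiability alone. Goursat's
    bisection is carried out on Riemann sums, which already vanish exactly for
    affine functions (goursat); in logarithmic coordinates around a point it gives
    the mean value property over roots of unity (circle_mean_cvg). The maximum
    principle follows, since |F| + ep |z|^2 has no interior maximum
    (maximum_modulus), and Phragmen-Lindelof follows from it with polynomial and
    exponential auxiliary factors.

    For the case of equality, y0 is a point of the polar of K at which |(a,y)|
    attains ||a||_K = M; it lies on the boundary. If the norm of f_0 is the square
    root of |C1|^2 + |C2|^2, then C1 = 0 or C2 = 0 (exp_pair_cross_term), and for a
    single exponential both sides at the origin are equal
    because |M cos alpha +- i M sin alpha| = M. *)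

(** * Modulus and exponential of complex numbers *)

(** Complex conjugation kept in the type of bundled complex numbers, so that
    its values can be differentiated and multiplied without casts. *)
Definition cconj (R : realType) (z : Cplx R) : Cplx R := conjc z.

Section Modulus.
Context {R : realType}.
Implicit Types (z w : Cplx R).

Lemma modulusE z : `|z| = ((modulus z)%:C)%C :> R[i].
Proof. by []. Qed.

Lemma modulus_ge0 z : 0 <= modulus z.
Proof. by case: z => a b; exact: sqrtr_ge0. Qed.

Lemma modulusM z w : modulus (z * w) = modulus z * modulus w.
Proof. exact: ComplexField.Normc.normcM. Qed.

Lemma modulusD z w : modulus (z + w) <= modulus z + modulus w.
Proof. exact: le_normcD. Qed.

Lemma modulusN z : modulus (- z) = modulus z.
Proof. exact: normcN. Qed.

Lemma modulusBC z w : modulus (z - w) = modulus (w - z).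
Proof. by rewrite -modulusN opprB. Qed.

Lemma modulusB z w : modulus (z - w) <= modulus z + modulus w.
Proof. by rewrite -(modulusN w) modulusD. Qed.

Lemma modulus0 : modulus (0 : Cplx R) = 0.
Proof. exact: ComplexField.Normc.normc0. Qed.

Lemma modulus1 : modulus (1 : Cplx R) = 1.
Proof. exact: ComplexField.Normc.normc1. Qed.

Lemma modulus_eq0 z : (modulus z == 0) = (z == 0).
Proof.
by apply/eqP/eqP => [/ComplexField.Normc.eq0_normc //|->]; exact: modulus0.
Qed.

Lemma modulus_gt0 z : (0 < modulus z) = (z != 0).
Proof. by rewrite lt_def modulus_ge0 andbT modulus_eq0. Qed.

Lemma modulusV z : modulus z^-1 = (modulus z)^-1.
Proof. exact: ComplexField.Normc.normcV. Qed.

Lemma modulus_sqr z :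
  modulus z ^+ 2 = complex.Re z ^+ 2 + complex.Im z ^+ 2.
Proof. by case: z => a b; rewrite /= sqr_sqrtr // addr_ge0 ?sqr_ge0. Qed.

Lemma modulus_real (a : R) : modulus (a%:C)%C = `|a|.
Proof. by rewrite /modulus /= expr0n addr0 sqrtr_sqr. Qed.

Lemma modulusJ z : modulus (cconj z) = modulus z.
Proof. by case: z => a b; rewrite /modulus /= sqrrN. Qed.

Lemma cconjK : involutive (@cconj R). Proof. exact: conjcK. Qed.
Lemma cconjD z w : cconj (z + w) = cconj z + cconj w.
Proof. exact: rmorphD. Qed.
Lemma cconjB z w : cconj (z - w) = cconj z - cconj w.
Proof. exact: rmorphB. Qed.
Lemma cconjM z w : cconj (z * w) = cconj z * cconj w.
Proof. exact: rmorphM. Qed.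

Lemma modulus_lerB z w : modulus z - modulus w <= modulus (z - w).
Proof. by rewrite lerBlDr (le_trans _ (modulusD _ _)) // subrK. Qed.

Lemma Re_le_modulus z : `|complex.Re z| <= modulus z.
Proof.
case: z => a b; rewrite /modulus /= -sqrtr_sqr ler_wsqrtr //.
by rewrite lerDl sqr_ge0.
Qed.

Lemma Im_le_modulus z : `|complex.Im z| <= modulus z.
Proof.
case: z => a b; rewrite /modulus /= -sqrtr_sqr ler_wsqrtr //.
by rewrite lerDr sqr_ge0.
Qed.

Lemma modulus_le_ReIm z : modulus z <= `|complex.Re z| + `|complex.Im z|.
Proof.
rewrite -(ler_pXn2r (n := 2)) // ?nnegrE ?addr_ge0 ?modulus_ge0 //.
rewrite modulus_sqr sqrrD !real_normK ?num_real // addrAC lerDl.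
by rewrite mulrn_wge0 // mulr_ge0.
Qed.

Lemma modulus_sum (I : Type) (r : seq I) (P : pred I) (F : I -> Cplx R) :
  modulus (\sum_(i <- r | P i) F i) <= \sum_(i <- r | P i) modulus (F i).
Proof.
elim/big_rec2: _ => [|i y x _ IH]; first by rewrite modulus0.
by rewrite (le_trans (modulusD _ _)) // lerD2l.
Qed.

Lemma modulusX z n : modulus (z ^+ n) = modulus z ^+ n.
Proof.
by elim: n => [|n IH]; rewrite ?expr0 ?modulus1 // !exprS modulusM IH.
Qed.

Lemma cReM z w : complex.Re (z * w : Cplx R) =
  complex.Re z * complex.Re w - complex.Im z * complex.Im w.
Proof. by case: z; case: w. Qed.

Lemma cImM z w : complex.Im (z * w : Cplx R) =
  complex.Re z * complex.Im w + complex.Im z * complex.Re w.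
Proof. by case: z; case: w. Qed.

Lemma cReD z w : complex.Re (z + w : Cplx R) = complex.Re z + complex.Re w.
Proof. by case: z; case: w. Qed.
Lemma cImD z w : complex.Im (z + w : Cplx R) = complex.Im z + complex.Im w.
Proof. by case: z; case: w. Qed.
Lemma cReN z : complex.Re (- z : Cplx R) = - complex.Re z.
Proof. by case: z. Qed.
Lemma cImN z : complex.Im (- z : Cplx R) = - complex.Im z.
Proof. by case: z. Qed.

Definition ReImE := (cReM, cImM, cReD, cImD, cReN, cImN).

Lemma complex_eq z w : complex.Re z = complex.Re w ->
  complex.Im z = complex.Im w -> z = w.
Proof. by case: z => a b; case: w => c d /= -> ->. Qed.

Lemma cexpD z w : cexp (z + w) = cexp z * cexp w.
Proof.
case: z => a b; case: w => c d; apply: complex_eq; rewrite /= expRD.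
  by rewrite cosD; ring.
by rewrite sinD; ring.
Qed.

Lemma cexp0 : cexp (0 : Cplx R) = 1.
Proof. by apply: complex_eq; rewrite /= expR0 ?cos0 ?sin0 ?mulr1 ?mulr0. Qed.

Lemma modulus_cexp z : modulus (cexp z) = expR (complex.Re z).
Proof.
case: z => a b; rewrite /modulus /= !exprMn -mulrDr cos2Dsin2 mulr1.
by rewrite sqrtr_sqr ger0_norm // expR_ge0.
Qed.

End Modulus.

(** * Complex derivatives *)

(** The epsilon-delta form of complex differentiability with real-valued
    moduli. It is equivalent to the derivative of the one-dimensional normed
    space (has_cderivP), and it is the form in which conjugation, real
    directions and Goursat's argument are easily handled. *)
Definition has_cderiv (R : realType) (F : Cplx R -> Cplx R) (z d : Cplx R) :=
  forall e : R, 0 < e -> exists2 r : R, 0 < r &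
    forall h, modulus h < r ->
      modulus (F (z + h) - F z - d * h) <= e * modulus h.

Section Deriv.
Context {R : realType}.
Implicit Types (z w : Cplx R) (F G : Cplx R -> Cplx R).

Lemma gt0_CplxP (e : Cplx R) : 0 < e -> e = ((complex.Re e)%:C)%C /\ 0 < complex.Re e.
Proof. by case: e => a b; rewrite ltcE /= => /andP[/eqP -> ]. Qed.

Lemma Cplx_ltE (a b : R) : ((a%:C)%C < (b%:C)%C :> Cplx R) = (a < b).
Proof. by rewrite ltcR. Qed.
Lemma Cplx_leE (a b : R) : ((a%:C)%C <= (b%:C)%C :> Cplx R) = (a <= b).
Proof. by rewrite lecR. Qed.

Lemma nbhs_CplxP (V : normedModType (Cplx R)) (x : V) (P : set V) :
  nbhs x P <-> exists2 r : R, 0 < r & forall y, `|x - y| < (r%:C)%C -> P y.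
Proof.
split.
  move/nbhs_ballP => [e /= e0 eP].
  have [eE re0] := gt0_CplxP e0.
  exists (complex.Re e) => // y; rewrite -eE => xy; apply: eP.
  by rewrite -ball_normE.
move=> [r r0 rP]; apply/nbhs_ballP; exists (r%:C)%C; first by rewrite /= Cplx_ltE.
by move=> y; rewrite -ball_normE; exact: rP.
Qed.

(** Both sides say that the difference quotient tends to d; they differ in
    that the distances are real on the left and complex on the right, and
    positive complex numbers are exactly the positive reals. *)
Lemma has_cderivP F z d : has_cderiv F z d <-> is_derive z 1 F d.
Proof.
split.
- move=> Fd.
  have cv : h^-1 *: ((F \o shift z) (h *: 1) - F z) @[h --> (0:Cplx R)^'] --> d.
    apply/cvgrPdist_le => e /gt0_CplxP [-> e0].
    have [r r0 rP] := Fd _ e0.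
    apply/nbhs_CplxP; exists r => // h; rewrite sub0r normrN modulusE Cplx_ltE => hr h0.
    rewrite modulusE Cplx_leE /=.
    have := rP _ hr.
    rewrite -ler_pdivrMr ?modulus_gt0 // -modulusV -modulusM.
    move=> H; rewrite modulusBC.
    suff <- : (F (z + h) - F z - d * h) / h = h^-1 *: (F (h *: 1 + z) - F z) - d by [].
    rewrite /GRing.scale /= mulr1 (addrC h) mulrBl mulfK // mulrC //.
  apply: DeriveDef; first by apply/cvg_ex; exists d.
  exact: cvg_lim cv.
- case=> /cvg_ex [l cv] dE.
  have {}dE : l = d by rewrite -dE; apply/esym; exact: cvg_lim cv.
  subst l => e e0.
  have e0' : (0:Cplx R) < (e%:C)%C by rewrite Cplx_ltE.
  have /cvgrPdist_le/(_ _ e0')/nbhs_CplxP[r r0 rP] := cv.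
  exists r => // h hr.
  have [->|h0] := eqVneq h 0.
    by rewrite addr0 subrr mulr0 subrr modulus0 mulr0.
  have := rP h; rewrite sub0r normrN modulusE Cplx_ltE => /(_ hr h0).
  rewrite modulusE Cplx_leE /= => H.
  rewrite -ler_pdivrMr ?modulus_gt0 // -modulusV -modulusM; move: H; rewrite modulusBC.
  suff -> : (F (z + h) - F z - d * h) / h = h^-1 *: (F (h *: 1 + z) - F z) - d by [].
  by rewrite /GRing.scale /= mulr1 (addrC h) mulrBl mulfK // mulrC.
Qed.

Lemma has_cderiv_diff F z d : has_cderiv F z d -> differentiable F z.
Proof. by move/has_cderivP => [Fd _]; apply/derivable1_diffP. Qed.

Lemma diff_has_cderiv F z : differentiable F z -> exists d, has_cderiv F z d.
Proof.
move/derivable1_diffP => Fd; exists ('D_1 F z); apply/has_cderivP.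
exact: derivableP.
Qed.

Lemma has_cderiv_unique F z d d' :
  has_cderiv F z d -> has_cderiv F z d' -> d = d'.
Proof. by move=> /has_cderivP[_ <-] /has_cderivP[_ <-]. Qed.

Lemma has_cderivD F G z d d' : has_cderiv F z d -> has_cderiv G z d' ->
  has_cderiv (fun w => F w + G w) z (d + d').
Proof. by move=> /has_cderivP ? /has_cderivP ?; apply/has_cderivP. Qed.

Lemma has_cderivMl F z d c : has_cderiv F z d ->
  has_cderiv (fun w => c * F w) z (c * d).
Proof. by move=> /has_cderivP Fd; apply/has_cderivP. Qed.

Lemma differentiable_idC z : differentiable (fun w : Cplx R => w) z.
Proof.
apply: (@has_cderiv_diff _ _ 1) => e e0; exists 1 => // h _.
have -> : z + h - z - 1 * h = 0 by ring.
rewrite modulus0.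
exact: mulr_ge0 (ltW e0) (modulus_ge0 _).
Qed.

Lemma has_cderiv_affine F z p c d : has_cderiv F (p + c * z) d ->
  has_cderiv (fun w => F (p + c * w)) z (c * d).
Proof.
have [->|c0] := eqVneq c 0.
  move=> _ e e0; exists 1 => // h _.
  rewrite !mul0r subrr subr0 modulus0.
  exact: mulr_ge0 (ltW e0) (modulus_ge0 _).
move=> Fd e e0.
have mc : 0 < modulus c by rewrite modulus_gt0.
have [r r0 rP] := Fd _ (divr_gt0 e0 mc).
exists (r / modulus c); first exact: divr_gt0.
move=> h; rewrite ltr_pdivlMr // => hr.
rewrite mulrDr addrA (mulrC c d) -mulrA.
have := rP (c * h); rewrite modulusM (mulrC (modulus c)) => /(_ hr) /le_trans; apply.
by rewrite (mulrC (modulus h)) mulrA divfK // modulus_eq0.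
Qed.

Lemma differentiable_affine F z p c : differentiable F (p + c * z) ->
  differentiable (fun w => F (p + c * w)) z.
Proof.
by move=> /diff_has_cderiv[d /has_cderiv_affine Fd]; exact: has_cderiv_diff Fd.
Qed.

(** Conjugating before and after preserves complex differentiability, the
    derivative being conjugated as well. This provides the Schwarz
    reflection used in the comparison on the upper half-plane. *)
Lemma differentiable_conj F z : differentiable F (cconj z) ->
  differentiable (fun w => cconj (F (cconj w))) z.
Proof.
move=> /diff_has_cderiv[d Fd]; apply: (@has_cderiv_diff _ _ (cconj d)) => e e0.
have [r r0 rP] := Fd _ e0; exists r => // h hr.
have := rP (cconj h); rewrite modulusJ => /(_ hr).
by rewrite -modulusJ !cconjB !cconjD cconjM !cconjK.
Qed.

Lemma is_derive0_eps (f : R -> R) (d : R) : is_derive (0:R) (1:R) f d -> forall e : R, 0 < e ->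
  exists2 r : R, 0 < r & forall h : R, `|h| < r ->
    `|f h - f 0 - d * h| <= e * `|h|.
Proof.
case=> /cvg_ex [l cv] dE e e0.
have {}dE : l = d by rewrite -dE; apply/esym; exact: cvg_lim cv.
subst l.
have /cvgrPdist_le/(_ _ e0)/nbhs_ballP[r r0 rP] := cv.
exists r => // h hr.
have [->|h0] := eqVneq h 0; first by rewrite subrr mulr0 subr0 normr0 mulr0.
have := rP h; rewrite /ball /= sub0r normrN => /(_ hr h0).
rewrite addr0 => H.
rewrite -ler_pdivrMr ?normr_gt0 // -normrV ?unitfE // -normrM; move: H; rewrite distrC.
suff -> : (f h - f 0 - d * h) / h = h^-1 *: (f (h *: 1) - f 0) - d by [].
by rewrite /GRing.scale /= mulr1 mulrBl mulfK // mulrC.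
Qed.

(** The real and imaginary parts of exp(a + ib) - 1 - (a + ib) are sums of a
    first-order remainder of exp, cos or sin at 0 and of a product of two
    increments. *)
Lemma has_cderiv_cexp0 : has_cderiv (@cexp R) 0 1.
Proof.
move=> e e0.
have e8 : 0 < e / 8%:R by rewrite divr_gt0.
have [r1 r10 H1] := is_derive0_eps (is_derive_expR (0:R)) e8.
have [r2 r20 H2] := is_derive0_eps (is_derive_cos (0:R)) e8.
have [r3 r30 H3] := is_derive0_eps (is_derive_sin (0:R)) e8.
have [r4 r40 H4] := is_derive0_eps (is_derive_expR (0:R)) (@ltr01 R).
pose r := Num.min (Num.min (Num.min r1 r2) (Num.min r3 r4)) (Num.min (1/2%:R) (e/8%:R)).
exists r; first by rewrite !lt_min r10 r20 r30 r40 e8 divr_gt0.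
move=> h; rewrite !lt_min -!andbA => /and3P[h1 h2 /and4P[h3 h4 h5 h6]].
rewrite add0r cexp0 mul1r.
case: h h1 h2 h3 h4 h5 h6 => a b; set m := modulus _.
move=> h1 h2 h3 h4 h5 h6.
have am : `|a| <= m := Re_le_modulus (Complex a b).
have bm : `|b| <= m := Im_le_modulus (Complex a b).
have {}H1 := H1 _ (le_lt_trans am h1).
have {}H2 := H2 _ (le_lt_trans bm h2).
have {}H3 := H3 _ (le_lt_trans bm h3).
have {}H4 := H4 _ (le_lt_trans am h4).
move: H1 H2 H3 H4.
rewrite !expR0 sin0 cos0 oppr0 !mul0r !mul1r !subr0 => H1 H2 H3 H4.
have E2 : `|expR a| <= 2%:R.
  rewrite ger0_norm ?expR_ge0 //; have := le_trans H4 am; move: am h5.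
  by clear; rewrite !ler_norml; lra.
apply: (le_trans (modulus_le_ReIm _)).
rewrite (_ : complex.Re _ = (expR a - 1 - a) + expR a * (cos b - 1)); last first.
  by rewrite /=; ring.
rewrite (_ : complex.Im _ = (expR a * (sin b - b)) + (expR a - 1) * b); last first.
  by rewrite /=; ring.
have A2 : `|expR a * (cos b - 1)| <= 2%:R * (e / 8%:R * `|b|).
  by rewrite normrM ler_pM.
have A3 : `|expR a * (sin b - b)| <= 2%:R * (e / 8%:R * `|b|).
  by rewrite normrM ler_pM // -[sin b]addr0.
have A4 : `|(expR a - 1) * b| <= (2%:R * (e/8%:R)) * `|b|.
  rewrite normrM ler_wpM2r //.
  have := le_trans H4 am; move: am h6; clear; rewrite !ler_norml; lra.
have m0 : 0 <= m := modulus_ge0 _.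
have := ler_normD (expR a - 1 - a) (expR a * (cos b - 1)).
have := ler_normD (expR a * (sin b - b)) ((expR a - 1) * b).
have : e / 8%:R * `|a| <= e / 8%:R * m by rewrite ler_wpM2l // ltW.
have : e / 8%:R * `|b| <= e / 8%:R * m by rewrite ler_wpM2l // ltW.
have := mulr_ge0 (ltW e0) m0.
lra.
Qed.

(** The functional equation transports the derivative from 0 to z. *)
Lemma has_cderiv_cexp z : has_cderiv (@cexp R) z (cexp z).
Proof.
have H := @has_cderivMl _ _ _ (cexp z) has_cderiv_cexp0.
have E w : cexp (z + w) = cexp z * cexp w := cexpD z w.
move=> e e0; have [r r0 rP] := H e e0; exists r => // h hr.
have := rP h hr.
by rewrite -!E add0r addr0 mulr1.
Qed.

Lemma differentiable_cexp z : differentiable (@cexp R) z.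
Proof. exact: has_cderiv_diff (has_cderiv_cexp z). Qed.

Lemma has_cderiv_cexpZ c z :
  has_cderiv (fun w => cexp (c * w)) z (c * cexp (c * z)).
Proof.
have := @has_cderiv_affine (@cexp R) z 0 c _ (has_cderiv_cexp _).
by rewrite add0r; under eq_fun do rewrite add0r.
Qed.

Lemma has_cderiv_bound F z d : has_cderiv F z d -> forall e : R, 0 < e ->
  exists2 r : R, 0 < r & forall w, modulus (w - z) < r -> modulus (F w - F z) <= e.
Proof.
move=> Fd e e0; have [r r0 rP] := Fd _ (@ltr01 R).
have k0 : 0 < 1 + modulus d by rewrite ltr_wpDr // modulus_ge0.
exists (Num.min r (e / (1 + modulus d))); first by rewrite lt_min r0 divr_gt0.
move=> w; rewrite lt_min => /andP[wr we].
have := rP _ wr; rewrite mul1r (addrC z) subrK => H.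
have -> : F w - F z = (F w - F z - d * (w - z)) + d * (w - z) by rewrite subrK.
apply: (le_trans (modulusD _ _)); rewrite modulusM.
move: we; rewrite ltr_pdivlMr // => we.
by apply: le_trans (ltW we); rewrite (mulrDr (modulus _)) mulr1 lerD // mulrC.
Qed.

End Deriv.

(** * Goursat's theorem for Riemann sums and the mean value property *)
Section Goursat.
Context {R : realType}.
Implicit Types (p u v z : Cplx R) (G : Cplx R -> Cplx R).

(** The intervals [s k, s k + 2^-k] are nested; the supremum of their left
    ends lies in all of them. *)
Lemma nested_dyadic (s : nat -> R) :
  (forall k, s k.+1 = s k \/ s k.+1 = s k + 2^-1 ^+ k.+1) ->
  exists x, forall k, s k <= x <= s k + 2^-1 ^+ k.
Proof.
move=> H.
have h0 k : 0 < (2^-1 : R) ^+ k by rewrite exprn_gt0 // invr_gt0.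
have mono k n : s k <= s (k + n)%N /\
    s (k + n)%N + 2^-1 ^+ (k + n) <= s k + 2^-1 ^+ k.
  elim: n => [|n [IH1 IH2]]; first by rewrite addn0.
  have := h0 (k + n)%N; have := H (k + n)%N.
  by rewrite addnS exprS => -[] -> h; split; lra.
have ub k j : s j <= s k + 2^-1 ^+ k.
  have [jk|/ltnW kj] := leqP j k.
    by have [+ _] := mono j (k - j)%N; rewrite subnKC // => /le_trans; apply; rewrite lerDl ltW.
  have [_] := mono k (j - k)%N; rewrite subnKC // => /(le_trans _); apply.
  by rewrite lerDl ltW.
exists (sup (range s)) => k; apply/andP; split.
  apply: ub_le_sup; last by exists k.
  by exists (s 0%N + 2^-1 ^+ 0) => _ [j _ <-]; exact: ub.
apply: ge_sup; first by exists (s 0%N), 0%N.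
by move=> _ [j _ <-]; exact: ub.
Qed.

(** B k x concerns the dyadic cell of level k with lower left corner x.
    Passing again and again to a quarter satisfying B gives, in each of the
    two coordinates, a nested sequence of dyadic intervals. *)
Lemma bisection (B : nat -> R * R -> Prop) : B 0%N (0, 0) ->
  (forall k x, B k x -> exists y : R * R,
     [/\ y.1 = x.1 \/ y.1 = x.1 + 2^-1 ^+ k.+1,
         y.2 = x.2 \/ y.2 = x.2 + 2^-1 ^+ k.+1 & B k.+1 y]) ->
  exists s t : R, [/\ 0 <= s <= 1, 0 <= t <= 1 & forall k, exists2 x, B k x &
     x.1 <= s <= x.1 + 2^-1 ^+ k /\ x.2 <= t <= x.2 + 2^-1 ^+ k].
Proof.
move=> B0 BS.
have step (kx : nat * (R * R)) : exists y : R * R, B kx.1 kx.2 ->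
   [/\ y.1 = kx.2.1 \/ y.1 = kx.2.1 + 2^-1 ^+ kx.1.+1,
       y.2 = kx.2.2 \/ y.2 = kx.2.2 + 2^-1 ^+ kx.1.+1 & B kx.1.+1 y].
  have [/BS[y Hy]|nB] := pselect (B kx.1 kx.2); first by exists y.
  by exists 0.
have [f Hf] := choice step.
pose x_ := fix x_ k : R * R := if k is k'.+1 then f (k', x_ k') else (0, 0).
have Bx k : B k (x_ k).
  by elim: k => [//|k IH]; have [] := Hf (k, x_ k) IH.
have [|s Hs] := @nested_dyadic (fun k => (x_ k).1).
  by move=> k; have [] := Hf (k, x_ k) (Bx k).
have [|t Ht] := @nested_dyadic (fun k => (x_ k).2).
  by move=> k; have [] := Hf (k, x_ k) (Bx k).
exists s, t; split.
- by have := Hs 0%N; rewrite /= add0r expr0.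
- by have := Ht 0%N; rewrite /= add0r expr0.
- by move=> k; exists (x_ k).
Qed.

(** The left-endpoint Riemann sum, with n equal steps, of the integral of G
    along the segment from p to p + u. *)
Definition edge_sum G n p u : Cplx R :=
  \sum_(j < n) u / n%:R * G (p + u * (j%:R / n%:R)).

(** The corresponding sum for the counterclockwise boundary of the
    parallelogram with corner p and sides u, v. *)
Definition loop_sum G n p u v : Cplx R :=
  edge_sum G n p u - edge_sum G n (p + v) u
  + edge_sum G n (p + u) v - edge_sum G n p v.

Lemma edge_sum_bisect G n p u :
  edge_sum G (n + n) p u = edge_sum G n p (u / 2) + edge_sum G n (p + u / 2) (u / 2).
Proof.
have [->|n0] := posnP n; first by rewrite /edge_sum !big_ord0 addr0.
have n0' : n%:R != 0 :> Cplx R by rewrite pnatr_eq0 -lt0n.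
have nn0' : n%:R + n%:R != 0 :> Cplx R.
  by rewrite -natrD pnatr_eq0 addn_eq0 negb_and -lt0n n0.
rewrite /edge_sum big_split_ord /=; congr (_ + _); apply: eq_bigr => j _;
  rewrite !natrD.
- by congr (_ * G (p + _)); field; rewrite n0' nn0'.
- by rewrite -addrA; congr (_ * G (p + _)); field; rewrite n0' nn0'.
Qed.

(** The interior edges are traversed twice in opposite directions, and a sum
    with 2n steps over an edge is exactly the sum of the two n-step sums
    over its halves. *)
Lemma loop_sum_bisect G n p u v : loop_sum G (n + n) p u v =
  loop_sum G n p (u / 2) (v / 2) + loop_sum G n (p + u / 2) (u / 2) (v / 2)
  + loop_sum G n (p + v / 2) (u / 2) (v / 2)
  + loop_sum G n (p + u / 2 + v / 2) (u / 2) (v / 2).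
Proof.
rewrite /loop_sum !edge_sum_bisect.
have -> : p + u / 2 + u / 2 = p + u by field.
have -> : p + v / 2 + v / 2 = p + v by field.
have -> : p + u / 2 + v / 2 + v / 2 = p + v + u / 2 by field.
have -> : p + u / 2 + v / 2 + u / 2 = p + u + v / 2 by field.
rewrite (addrAC p (v / 2)); ring.
Qed.

Lemma edge_sumB G H n p u :
  edge_sum (fun z => G z - H z) n p u = edge_sum G n p u - edge_sum H n p u.
Proof. by rewrite /edge_sum -sumrB; apply: eq_bigr => j _; rewrite mulrBr. Qed.

Lemma loop_sumB G H n p u v :
  loop_sum (fun z => G z - H z) n p u v = loop_sum G n p u v - loop_sum H n p u v.
Proof. by rewrite /loop_sum !edge_sumB; ring. Qed.

(** Not just the integral but already its Riemann sum vanishes on affine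
    functions: on opposite edges the values differ by a constant. This is
    what makes Goursat's argument work without passing to integrals. *)
Lemma loop_sum_affine c d n p u v :
  loop_sum (fun z => c + d * z) n p u v = 0.
Proof.
have [->|n0] := posnP n; first by rewrite /loop_sum /edge_sum !big_ord0; ring.
have n0' : n%:R != 0 :> Cplx R by rewrite pnatr_eq0 -lt0n.
have E w q : edge_sum (fun z => c + d * z) n (p + q) w - edge_sum (fun z => c + d * z) n p w
   = d * q * w.
  rewrite /edge_sum -sumrB (eq_bigr (fun=> d * q * w / n%:R)); last by move=> i _; ring.
  by rewrite sumr_const card_ord -[LHS]mulr_natr divfK.
pose A := fun z => c + d * z.
transitivity (- (edge_sum A n (p + v) u - edge_sum A n p u)
  + (edge_sum A n (p + u) v - edge_sum A n p v)); first by rewrite /loop_sum; ring.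
by rewrite !E; ring.
Qed.

Lemma edge_sum_bound G n p u M : 0 <= M ->
  (forall s : R, 0 <= s <= 1 -> modulus (G (p + u * (s%:C)%C)) <= M) ->
  modulus (edge_sum G n p u) <= modulus u * M.
Proof.
move=> M0 H.
have [->|n0] := posnP n.
  by rewrite /edge_sum big_ord0 modulus0 mulr_ge0 // modulus_ge0.
have n0' : n%:R != 0 :> R by rewrite pnatr_eq0 -lt0n.
have nE k : k%:R = (k%:R%:C)%C :> Cplx R by rewrite rmorph_nat.
apply: (le_trans (modulus_sum _ _ _)).
apply: (@le_trans _ _ (\sum_(j < n) modulus u * M / n%:R)); last first.
  by rewrite sumr_const card_ord -[leLHS]mulr_natr divfK.
apply: ler_sum => j _.
rewrite modulusM modulusM modulusV nE modulus_real normr_nat mulrAC.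
rewrite ler_wpM2r ?invr_ge0 ?ler0n // ler_wpM2l ?modulus_ge0 //.
rewrite nE -fmorphV -rmorphM; apply: H.
by rewrite divr_ge0 ?ler0n //= ler_pdivrMr ?ltr0n // mul1r ler_nat ltnW.
Qed.

Lemma loop_sum_bound G n p u v M : 0 <= M ->
  (forall s t : R, 0 <= s <= 1 -> 0 <= t <= 1 ->
     modulus (G (p + u * (s%:C)%C + v * (t%:C)%C)) <= M) ->
  modulus (loop_sum G n p u v) <= 2 * (modulus u + modulus v) * M.
Proof.
move=> M0 H.
have i0 : 0 <= (0 : R) <= 1 by rewrite lexx ler01.
have i1 : 0 <= (1 : R) <= 1 by rewrite lexx ler01.
have H1 : modulus (edge_sum G n p u) <= modulus u * M.
  by apply: edge_sum_bound => // s s01; have := H _ _ s01 i0; rewrite mulr0 addr0.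
have H2 : modulus (edge_sum G n (p + v) u) <= modulus u * M.
  by apply: edge_sum_bound => // s s01; have := H _ _ s01 i1; rewrite mulr1 addrAC.
have H3 : modulus (edge_sum G n (p + u) v) <= modulus v * M.
  by apply: edge_sum_bound => // s s01; have := H _ _ i1 s01; rewrite mulr1.
have H4 : modulus (edge_sum G n p v) <= modulus v * M.
  by apply: edge_sum_bound => // s s01; have := H _ _ i0 s01; rewrite mulr0 addr0.
rewrite /loop_sum.
have := modulusB (edge_sum G n p u - edge_sum G n (p + v) u + edge_sum G n (p + u) v)
   (edge_sum G n p v).
have := modulusD (edge_sum G n p u - edge_sum G n (p + v) u) (edge_sum G n (p + u) v).
have := modulusB (edge_sum G n p u) (edge_sum G n (p + v) u).
lra.
Qed.

(** Goursat's bisection, performed on Riemann sums. If the sums did not tend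
    to 0, the failure, measured against the area, would pass to one quarter
    again and again, and so down to cells shrinking to a point z. On a small
    cell the affine part of G at z contributes nothing, and the remainder is
    at most epsilon times the diameter, so that the sum is at most a
    constant times epsilon times the area. *)
Theorem goursat G p u v :
  (forall s t : R, 0 <= s <= 1 -> 0 <= t <= 1 ->
     differentiable G (p + u * (s%:C)%C + v * (t%:C)%C)) ->
  forall e : R, 0 < e -> exists n0, forall n, (n0 <= n)%N ->
    modulus (loop_sum G (2 ^ n)%N p u v) <= e.
Proof.
move=> Gd e e0; apply: contrapT => /forallNP nH.
pose h k : R := 2^-1 ^+ k.
have h0 k : 0 < h k by rewrite exprn_gt0 // invr_gt0.
have hS k : h k.+1 = h k / 2 by rewrite /h exprSr.
pose corner (x : R * R) := p + u * (x.1%:C)%C + v * (x.2%:C)%C.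
(* The defect is measured against the area of the cell, which is what a
   quarter of it can inherit. *)
pose B k (x : R * R) := forall n0, exists2 n, (n0 <= n)%N &
  e * h k ^+ 2 < modulus (loop_sum G (2 ^ n)%N (corner x) (u * ((h k)%:C)%C) (v * ((h k)%:C)%C)).
have B0 : B 0%N (0, 0).
  move=> n0; have /existsNP[n /not_implyP[nn H]] := nH n0; exists n => //.
  by rewrite /corner /h expr0 !mulr0 !addr0 !mulr1 expr1n mulr1 ltNge; apply/negP.
have [k x Bkx|s [t [s01 t01 Hst]]] := bisection B0.
- apply: contrapT => /forallNP nB.
  have {}nB (y : R * R) : (y.1 = x.1 \/ y.1 = x.1 + h k.+1) ->
     (y.2 = x.2 \/ y.2 = x.2 + h k.+1) -> exists n0, forall n, (n0 <= n)%N ->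
     modulus (loop_sum G (2 ^ n)%N (corner y) (u * ((h k.+1)%:C)%C) (v * ((h k.+1)%:C)%C))
       <= e * h k.+1 ^+ 2.
    move=> y1 y2; apply: contrapT => /forallNP H; apply: (nB y); split=> // n0.
    have /existsNP[n /not_implyP[nn H']] := H n0; exists n => //.
    by rewrite ltNge; apply/negP.
  have [n1 H1] := nB (x.1, x.2) (or_introl erefl) (or_introl erefl).
  have [n2 H2] := nB (x.1 + h k.+1, x.2) (or_intror erefl) (or_introl erefl).
  have [n3 H3] := nB (x.1, x.2 + h k.+1) (or_introl erefl) (or_intror erefl).
  have [n4 H4] := nB (x.1 + h k.+1, x.2 + h k.+1) (or_intror erefl) (or_intror erefl).
  have [n] := Bkx (maxn (maxn n1 n2) (maxn n3 n4)).+1.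
  case: n => // n; rewrite ltnS !geq_max -!andbA => /and4P[m1 m2 m3 m4].
  rewrite expnS mul2n -addnn loop_sum_bisect.
  have {}H1 := H1 _ m1; have {}H2 := H2 _ m2; have {}H3 := H3 _ m3; have {}H4 := H4 _ m4.
  have hC w : w * ((h k)%:C)%C / 2 = w * ((h k.+1)%:C)%C.
    by rewrite hS rmorphM fmorphV /= rmorph_nat mulrA.
  rewrite !hC.
  have -> : corner x + u * ((h k.+1)%:C)%C = corner (x.1 + h k.+1, x.2).
    by rewrite /corner /= rmorphD /=; ring.
  have -> : corner x + v * ((h k.+1)%:C)%C = corner (x.1, x.2 + h k.+1).
    by rewrite /corner /= rmorphD /=; ring.
  have -> : corner (x.1 + h k.+1, x.2) + v * ((h k.+1)%:C)%C
     = corner (x.1 + h k.+1, x.2 + h k.+1).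
    by rewrite /corner /= rmorphD /=; ring.
  have -> : corner x = corner (x.1, x.2) by [].
  set a := loop_sum _ _ _ _ _ in H1 *.
  set b := loop_sum _ _ _ _ _ in H2 *.
  set c := loop_sum _ _ _ _ _ in H3 *.
  set d := loop_sum _ _ _ _ _ in H4 *.
  have := modulusD (a + b + c) d; have := modulusD (a + b) c; have := modulusD a b.
  have -> : e * h k ^+ 2 = 4 * (e * h k.+1 ^+ 2) by rewrite hS; field.
  lra.
(* All cells of the nested sequence contain z, and those of level k have
   diameter at most L * h k. *)
pose z := p + u * (s%:C)%C + v * (t%:C)%C.
have [d Gz] := diff_has_cderiv (Gd _ _ s01 t01).
pose L := modulus u + modulus v.
have L0 : 0 <= L by rewrite addr_ge0 ?modulus_ge0.
have K0 : 0 < 2 * L ^+ 2 + 1 by have := sqr_ge0 L; lra.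
have [r r0 rP] := Gz _ (divr_gt0 e0 K0).
have [k hk] : exists k, L * h k < r.
  exists (Num.bound (L / r)); rewrite /h exprVn ltr_pdivrMr ?exprn_gt0 //.
  rewrite mulrC -ltr_pdivrMr // (lt_trans (archi_boundP _)) ?divr_ge0 ?(ltW r0) //.
  by rewrite -natrX ltr_nat ltn_expl.
have [x Bx [xs xt]] := Hst k.
have [n _] := Bx 0%N.
apply/negP; rewrite -leNgt.
set T := loop_sum G _ _ _ _.
pose rem w := G w - (G z - d * z + d * w).
have -> : T = loop_sum rem (2 ^ n)%N (corner x) (u * ((h k)%:C)%C) (v * ((h k)%:C)%C).
  by rewrite loop_sumB loop_sum_affine subr0.
set e' := e / _ in rP.
have e'0 : 0 < e' by exact: divr_gt0.
apply: le_trans (@loop_sum_bound rem _ (corner x) (u * ((h k)%:C)%C)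
  (v * ((h k)%:C)%C) (e' * (L * h k)) _ _) _.
- exact: mulr_ge0 (ltW e'0) (mulr_ge0 L0 (ltW (h0 k))).
- move=> s' t' s'01 t'01; set w := _ + v * _ * _.
  have wz : modulus (w - z) <= L * h k.
    rewrite /w /z /corner.
    have -> : p + u * ((x.1)%:C)%C + v * ((x.2)%:C)%C + u * ((h k)%:C)%C * (s'%:C)%C
      + v * ((h k)%:C)%C * (t'%:C)%C - (p + u * (s%:C)%C + v * (t%:C)%C) =
      u * ((x.1 + h k * s' - s)%:C)%C + v * ((x.2 + h k * t' - t)%:C)%C.
      by rewrite !rmorphB !rmorphD !rmorphM /=; ring.
    apply: (le_trans (modulusD _ _)); rewrite !modulusM !modulus_real mulrDl.
    have hh a b c : 0 <= c <= 1 -> a <= b <= a + h k -> `|a + h k * c - b| <= h k.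
      move=> /andP[c0 c1] /andP[a1 a2].
      have := mulr_ge0 (ltW (h0 k)) c0.
      have : h k * c <= h k by rewrite ler_piMr // ltW.
      by rewrite ler_norml; lra.
    by apply: lerD; rewrite ler_wpM2l ?modulus_ge0 // hh.
  have -> : rem w = G (z + (w - z)) - G z - d * (w - z).
    rewrite /rem.
    by rewrite (addrC z) subrK; ring.
  apply: le_trans (rP _ (le_lt_trans wz hk)) _.
  by rewrite ler_wpM2l // ltW.
rewrite !modulusM !modulus_real (ger0_norm (ltW (h0 k))) -mulrDl -/L.
have -> : 2 * (L * h k) * (e' * (L * h k)) = e' * (2 * L ^+ 2) * h k ^+ 2 by ring.
rewrite ler_wpM2r ?sqr_ge0 // /e' mulrAC ler_pdivrMr // ler_wpM2l ?ltW //.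
by rewrite ltrDl.
Qed.

Lemma cexp_period z : cexp (z + (0 +i* (pi *+ 2))%C) = cexp z.
Proof.
by case: z => a b; rewrite /cexp /= addr0 cosD2pi sinD2pi.
Qed.

(** Roots of unity in place of an integral over the circle. *)
Definition circle_mean (F : Cplx R -> Cplx R) n z (r : R) : Cplx R :=
  (\sum_(j < n) F (z + (r%:C)%C * cexp (0 +i* (pi *+ 2 * (j%:R / n%:R)))%C)) / n%:R.

(** The mean value property. In the coordinate w of z + exp w, an annulus
    becomes a rectangle of height 2 pi, whose horizontal sides cancel by
    periodicity; Goursat's theorem therefore says that the means over two
    concentric circles agree in the limit. The inner circle can be taken so
    small that F is almost constant on it. *)
Theorem circle_mean_cvg F z r : 0 < r ->
  (forall w, modulus (w - z) <= r -> differentiable F w) ->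
  forall e : R, 0 < e -> exists n0, forall n, (n0 <= n)%N ->
    modulus (circle_mean F (2 ^ n)%N z r - F z) <= e.
Proof.
move=> r0 Fd e e0.
have [d Fz] : exists d, has_cderiv F z d.
  by apply: diff_has_cderiv; apply: Fd; rewrite subrr modulus0 ltW.
have e20 : 0 < e / 2 by rewrite divr_gt0.
have [q q0 qP] := has_cderiv_bound Fz e20.
pose G w := F (z + cexp w).
(* A width that brings the inner radius exp (ln r - s) down to at most q / 2. *)
pose s : R := Num.max 0 (ln r - ln (q / 2)).
have s0 : 0 <= s by rewrite le_max lexx.
have q2 : 0 < q / 2 by rewrite divr_gt0.
pose p : Cplx R := ((ln r - s)%:C)%C.
pose u : Cplx R := (s%:C)%C.
pose v : Cplx R := (0 +i* (pi *+ 2))%C.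
have Re_exp (s' t' : R) : complex.Re (p + u * (s'%:C)%C + v * (t'%:C)%C) = ln r - s + s * s'.
  by rewrite !ReImE /=; ring.
have Gd (s' t' : R) : 0 <= s' <= 1 -> 0 <= t' <= 1 ->
     differentiable G (p + u * (s'%:C)%C + v * (t'%:C)%C).
  move=> /andP[s'0 s'1] _; apply: (@differentiable_comp _ _ _ _ (fun w => z + cexp w) F).
    by apply: differentiableD => //; exact: differentiable_cexp.
  apply: Fd; rewrite addrAC subrr add0r modulus_cexp Re_exp -[leRHS](lnK r0) ler_expR.
  have : s * s' <= s by rewrite ler_piMr.
  lra.
have pi0 : 0 < (pi *+ 2 : R) by rewrite mulrn_wgt0 // pi_gt0.
have e2p : 0 < e / 2 * (pi *+ 2) by rewrite mulr_gt0.
have [n0 Hn] := goursat Gd e2p.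
exists n0 => n /Hn.
have n20 : (0 < 2 ^ n)%N by rewrite expn_gt0.
move: (2 ^ n)%N n20 => N N0.
have N0' : N%:R != 0 :> Cplx R by rewrite pnatr_eq0 -lt0n.
have nE k : k%:R = (k%:R%:C)%C :> Cplx R by rewrite rmorph_nat.
have cexp_real (a b : R) :
    cexp ((a%:C)%C + (0 +i* b)%C : Cplx R) = ((expR a)%:C)%C * cexp (0 +i* b)%C.
  rewrite cexpD; congr (_ * _).
  by apply: complex_eq; rewrite /= ?cos0 ?sin0 ?mulr1 ?mulr0.
have arg (j : nat) : v * (j%:R / N%:R) = (0 +i* (pi *+ 2 * (j%:R / N%:R)))%C.
  by rewrite !nE -fmorphV -rmorphM; apply: complex_eq; rewrite /v /=; ring.
have vert (a : R) : edge_sum G N ((a%:C)%C) v = v * circle_mean F N z (expR a).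
  rewrite /edge_sum /circle_mean mulrA mulrAC mulr_sumr; apply: eq_bigr => j _.
  by rewrite /G arg cexp_real.
have pu : p + u = ((ln r)%:C)%C by rewrite /p /u -rmorphD subrK.
rewrite /loop_sum.
have -> : edge_sum G N (p + v) u = edge_sum G N p u.
  by apply: eq_bigr => j _; rewrite /G addrAC cexp_period.
rewrite subrr add0r pu !vert lnK ?posrE // -mulrBr modulusM.
have -> : modulus v = pi *+ 2.
  by rewrite /modulus /v /= expr0n add0r sqrtr_sqr ger0_norm // ltW.
rewrite mulrC ler_pM2r // => H1.
set r' := expR _ in H1.
have r'q : r' < q.
  apply: (@le_lt_trans _ _ (q / 2)); last by rewrite ltr_pdivrMr // ltr_pMr // ltr1n.
  rewrite /r' -[leRHS](lnK q2) ler_expR.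
  have : ln r - ln (q / 2) <= s by rewrite le_max lexx orbT.
  lra.
have H2 : modulus (circle_mean F N z r' - F z) <= e / 2.
  have -> : circle_mean F N z r' - F z =
     (\sum_(j < N) (F (z + (r'%:C)%C * cexp (0 +i* (pi *+ 2 * (j%:R / N%:R)))%C) - F z)) / N%:R.
    by rewrite sumrB sumr_const card_ord mulrBl -[X in _ - X / _]mulr_natr mulfK.
  rewrite modulusM modulusV nE modulus_real normr_nat ler_pdivrMr ?ltr0n //.
  apply: (le_trans (modulus_sum _ _ _)).
  rewrite mulr_natr -[leRHS](_ : \sum_(j < N) e / 2 = _); last by rewrite sumr_const card_ord.
  apply: ler_sum => j _; apply: qP.
  by rewrite addrAC subrr add0r modulusM modulus_real modulus_cexp /= expR0 mulr1 ger0_norm ?expR_ge0.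
have -> : circle_mean F N z r - F z =
  (circle_mean F N z r - circle_mean F N z r') + (circle_mean F N z r' - F z).
  by ring.
apply: (le_trans (modulusD _ _)); lra.
Qed.

End Goursat.

(** * The maximum modulus principle *)
Section MaxModulus.
Context {R : realType}.
Implicit Types (z w : Cplx R) (F : Cplx R -> Cplx R).

Lemma modulus_lipschitz_continuous (f : Cplx R -> R) :
  (forall z w, `|f z - f w| <= modulus (z - w)) -> continuous f.
Proof.
move=> H z; apply/(@cvgrPdist_le _ _ _ (nbhs z)) => e e0.
apply/nbhs_CplxP; exists e => // w; rewrite modulusE Cplx_ltE => zw.
exact: le_trans (H _ _) (ltW zw).
Qed.

Lemma Re_continuous : continuous (fun z => complex.Re z).
Proof. by apply: modulus_lipschitz_continuous => z w; rewrite -cReN -cReD Re_le_modulus. Qed.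

Lemma Im_continuous : continuous (fun z => complex.Im z).
Proof. by apply: modulus_lipschitz_continuous => z w; rewrite -cImN -cImD Im_le_modulus. Qed.

Lemma modulus_continuous : continuous (@modulus R).
Proof.
apply: modulus_lipschitz_continuous => z w; rewrite ler_norml modulus_lerB andbT.
by rewrite lerNl opprB modulusBC modulus_lerB.
Qed.

Lemma bounded_closed_compact_Cplx (D : set (Cplx R)) (L : R) : closed D ->
  (forall z, D z -> modulus z <= L) -> compact D.
Proof.
move=> cD DL.
pose toC (x : R * R) : Cplx R := Complex x.1 x.2.
have ctoC : continuous toC.
  move=> x; apply/(@cvgrPdist_le _ _ _ (nbhs x)) => e /gt0_CplxP[-> e0].
  set d := complex.Re e in e0 *.
  have d2 : 0 < d / 2 by rewrite divr_gt0.
  exists (ball x.1 (d / 2), ball x.2 (d / 2)) => /=; first by split; exact: nbhsx_ballx.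
  move=> [a b] [/= h1 h2]; rewrite modulusE Cplx_leE.
  apply: le_trans (modulus_le_ReIm _) _.
  move: h1 h2; rewrite /ball /= => h1 h2.
  rewrite [leRHS](splitr d); exact: lerD (ltW h1) (ltW h2).
have cb : compact (toC @` (`[-L, L] `*` `[-L, L])).
  apply: continuous_compact; first exact: continuous_subspaceT.
  by apply: compact_setX; exact: segment_compact.
apply: subclosed_compact cD cb _ => z Dz.
exists (complex.Re z, complex.Im z); last by case: (z).
by split; rewrite /= in_itv /= -ler_norml (le_trans _ (DL _ Dz)) // ?Re_le_modulus ?Im_le_modulus.
Qed.

(** The function |F| + ep |.|^2 is strictly subharmonic: on every circle
    about z it exceeds somewhere its value at z. Its mean over the roots of
    unity is at least |F z| + ep |z|^2 + ep r^2 up to an arbitrarily small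
    error, by the mean value property applied to F and to the identity. *)
Lemma circle_mean_strict F z r (ep : R) : 0 < r -> 0 < ep ->
  (forall w, modulus (w - z) <= r -> differentiable F w) ->
  exists2 w, modulus (w - z) = r &
    modulus (F z) + ep * modulus z ^+ 2 < modulus (F w) + ep * modulus w ^+ 2.
Proof.
move=> r0 ep0 Fd; apply: contrapT => /forall2NP H.
have {}H w : modulus (w - z) = r -> modulus (F w) + ep * modulus w ^+ 2 <=
    modulus (F z) + ep * modulus z ^+ 2.
  by move=> wr; have [//|/negP] := H w; rewrite -leNgt.
have k0 : 0 < 1 + 2 * ep * modulus z.
  by rewrite ltr_wpDr // !mulr_ge0 ?modulus_ge0 // ltW.
(* The mean of ep |.|^2 gains ep r^2; replacing the means by their limits
   costs e for |F| and 2 ep |z| e for the square. *)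
pose e := ep * r ^+ 2 / (2 * (1 + 2 * ep * modulus z)).
have e0 : 0 < e by rewrite divr_gt0 ?mulr_gt0 ?exprn_gt0.
have [n1 H1] := circle_mean_cvg r0 Fd e0.
have [|n2 H2] := @circle_mean_cvg _ (fun w => w) z r r0 _ e e0.
  by move=> w _; exact: differentiable_idC.
have {}H1 := H1 _ (leq_maxl n1 n2); have {}H2 := H2 _ (leq_maxr n1 n2).
have N0 : (0 < 2 ^ maxn n1 n2)%N by rewrite expn_gt0.
move: (2 ^ _)%N N0 H1 H2 => N N0; rewrite /circle_mean.
pose w_ (j : 'I_N) := z + (r%:C)%C * cexp (0 +i* (pi *+ 2 * (j%:R / N%:R)))%C.
move=> H1 H2.
have N0' : 0 < N%:R :> R by rewrite ltr0n.
have nE : N%:R = (N%:R%:C)%C :> Cplx R by rewrite rmorph_nat.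
pose phi w := complex.Re z * complex.Re w + complex.Im z * complex.Im w.
have phiD : {morph phi : x y / x + y} by move=> x y; rewrite /phi cReD cImD; ring.
have phi0 : phi 0 = 0 by rewrite /phi /= !mulr0 addr0.
have wr j : modulus (w_ j - z) = r.
  by rewrite /w_ addrAC subrr add0r modulusM modulus_real modulus_cexp /= expR0 mulr1 gtr0_norm.
have w2 j : modulus (w_ j) ^+ 2 = r ^+ 2 + 2 * phi (w_ j) - modulus z ^+ 2.
  by rewrite -(wr j) !modulus_sqr /phi !ReImE; ring.
have S : \sum_(j < N) (modulus (F (w_ j)) + ep * (r ^+ 2 + 2 * phi (w_ j) - modulus z ^+ 2))
   <= N%:R * (modulus (F z) + ep * modulus z ^+ 2).
  rewrite mulr_natl -[leRHS](_ : \sum_(j < N) (modulus (F z) + ep * modulus z ^+ 2) = _); last first.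
    by rewrite sumr_const card_ord.
  by apply: ler_sum => j _; rewrite -w2 H.
pose A := (\sum_(j < N) F (w_ j)) / N%:R.
pose I := (\sum_(j < N) w_ j) / N%:R.
have HA : modulus (A - F z) <= e by [].
have HI : modulus (I - z) <= e by [].
have SA : N%:R * modulus A <= \sum_(j < N) modulus (F (w_ j)).
  rewrite /A modulusM modulusV nE modulus_real normr_nat mulrC divfK ?gt_eqF //.
  exact: modulus_sum.
have SI : \sum_(j < N) phi (w_ j) = N%:R * phi I.
  rewrite -(big_morph phi phiD phi0).
  have -> : \sum_(j < N) w_ j = (N%:R%:C)%C * I.
    by rewrite /I -nE mulrC divfK // nE lt0r_neq0 // ltcR.
  by rewrite /phi !ReImE /=; ring.
have phiI : modulus z ^+ 2 - modulus z * e <= phi I.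
  have -> : phi I = modulus z ^+ 2 + complex.Re (cconj z * (I - z)).
    by rewrite modulus_sqr /phi; case: (z) => a b; case: (I) => c d /=; ring.
  have : `|complex.Re (cconj z * (I - z))| <= modulus z * e.
    apply: le_trans (Re_le_modulus _) _.
    by rewrite modulusM modulusJ ler_wpM2l ?modulus_ge0.
  by rewrite ler_norml; lra.
have FA : modulus (F z) - e <= modulus A.
  by have := modulus_lerB (F z) A; rewrite modulusBC; lra.
have S2 : \sum_(j < N) (r ^+ 2 + 2 * phi (w_ j) - modulus z ^+ 2) =
    N%:R * (r ^+ 2 + 2 * phi I - modulus z ^+ 2).
  rewrite sumrB big_split /= !sumr_const card_ord -mulr_sumr SI.
  rewrite -(mulr_natl (r ^+ 2)) -(mulr_natl (modulus z ^+ 2)).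
  by ring.
move: S; rewrite big_split /= -mulr_sumr S2 => S.
have : N%:R * (modulus A + ep * (r ^+ 2 + 2 * phi I - modulus z ^+ 2)) <=
  N%:R * (modulus (F z) + ep * modulus z ^+ 2).
  by apply: le_trans S; move: SA; lra.
rewrite ler_pM2l // => H3.
have H4 : ep * (modulus z ^+ 2 - modulus z * e) <= ep * phi I by rewrite ler_wpM2l // ltW.
have : ep * r ^+ 2 <= e * (1 + 2 * ep * modulus z) by lra.
have -> : e * (1 + 2 * ep * modulus z) = ep * r ^+ 2 / 2.
  by rewrite /e; field; rewrite gt_eqF.
move=> H5.
have : 0 < ep * r ^+ 2 by rewrite mulr_gt0 // exprn_gt0.
lra.
Qed.

(** The strictly subharmonic function |F| + ep |.|^2 attains its maximum
    over the compact set D, but by circle_mean_strict not at a point with a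
    disc around it in D, hence on B; then ep tends to 0. The set B plays the
    role of the boundary. *)
Theorem maximum_modulus (D B : set (Cplx R)) F (M L : R) : closed D ->
  (forall z, D z -> modulus z <= L) ->
  (forall z, D z -> differentiable F z) ->
  (forall z, D z -> B z \/ exists2 r : R, 0 < r & forall w, modulus (w - z) <= r -> D w) ->
  (forall z, D z -> B z -> modulus (F z) <= M) ->
  forall z, D z -> modulus (F z) <= M.
Proof.
move=> cD DL Fd DB FB p Dp; rewrite leNgt; apply/negP => Mp.
have L0 : 0 <= L by apply: le_trans (DL _ Dp); exact: modulus_ge0.
pose ep := (modulus (F p) - M) / (L ^+ 2 + 1).
have k0 : 0 < L ^+ 2 + 1 by rewrite ltr_wpDl ?sqr_ge0.
have ep0 : 0 < ep by rewrite divr_gt0 // subr_gt0.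
pose u z := modulus (F z) + ep * modulus z ^+ 2.
have [||z] := @compact_EVT_max _ _ u D _ (bounded_closed_compact_Cplx cD DL).
- by exists p.
- apply: continuous_in_subspaceT => z /set_mem Dz.
  have c1 : {for z, continuous (fun w => modulus (F w))}.
    apply: (@continuous_comp _ _ _ F (@modulus R)); last exact: modulus_continuous.
    exact: differentiable_continuous (Fd _ Dz).
  have c2 : {for z, continuous (fun w => ep * modulus w ^+ 2)}.
    apply: (@continuousM _ _ (fun=> ep) (fun w => modulus w ^+ 2)); first exact: cst_continuous.
    by apply: (@continuousM _ _ (@modulus R) (@modulus R)); exact: modulus_continuous.
  exact: (@continuousD _ _ _ (fun w => modulus (F w)) _ _ c1 c2).
move=> /set_mem Dz zmax.
have [Bz|[r r0 rD]] := DB _ Dz.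
  have := zmax p (mem_set Dp); rewrite /u => H.
  have := FB _ Dz Bz.
  have : ep * modulus z ^+ 2 <= ep * L ^+ 2.
    by rewrite ler_wpM2l ?ler_pXn2r ?nnegrE ?modulus_ge0 ?DL // ltW.
  have : ep * (L ^+ 2 + 1) = modulus (F p) - M by rewrite divfK // gt_eqF.
  have := mulr_ge0 (ltW ep0) (sqr_ge0 (modulus p)).
  lra.
have [w wr] := circle_mean_strict r0 ep0 (fun w wz => Fd w (rD w wz)).
apply/negP; rewrite -leNgt; apply: zmax.
by apply/mem_set/rD; rewrite wr.
Qed.

End MaxModulus.

(** * Phragmen-Lindelof theorems *)
Section PhragmenLindelof.
Context {R : realType}.
Implicit Types (z w : Cplx R) (F g : Cplx R -> Cplx R).

Lemma closed_halfplane (a b c : R) :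
  closed [set z : Cplx R | c <= a * complex.Re z + b * complex.Im z].
Proof.
pose f := fun z : Cplx R => a * complex.Re z + b * complex.Im z.
rewrite (_ : mkset _ = f @^-1` [set x | c <= x]) //.
apply: closed_comp; last exact: closed_ge.
move=> z _.
have c1 : {for z, continuous (fun z : Cplx R => a * complex.Re z)}.
  apply: (@continuousM _ _ (fun=> a)); [exact: cst_continuous|exact: Re_continuous].
have c2 : {for z, continuous (fun z : Cplx R => b * complex.Im z)}.
  apply: (@continuousM _ _ (fun=> b)); [exact: cst_continuous|exact: Im_continuous].
exact: (@continuousD _ _ _ (fun z => a * complex.Re z) _ _ c1 c2).
Qed.

(** Used to remove the auxiliary factors of the Phragmen-Lindelof arguments. *)
Lemma le_expR_eps (A B p : R) : 0 <= p ->
  (forall ep, 0 < ep -> A <= B * expR (ep * p)) -> A <= B.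
Proof.
move=> p0 H; rewrite leNgt; apply/negP => BA.
have [A0|A0] := leP A 0.
  have := H 1 ltr01; rewrite mul1r.
  have : B * expR p <= B by rewrite ger_nMr ?(lt_le_trans BA) // -expR0 ler_expR.
  lra.
have k0 : 0 < 2 * (A * p) + 1 by have := mulr_ge0 (ltW A0) p0; lra.
pose ep := (A - B) / (2 * (A * p) + 1).
have ep0 : 0 < ep by rewrite divr_gt0 // subr_gt0.
have H1 := H _ ep0.
have : A * expR (- (ep * p)) <= B.
  rewrite expRN -ler_pdivlMr ?invr_gt0 ?expR_gt0 // invrK //.
have H2 : 1 - ep * p <= expR (- (ep * p)) := expR_ge1Dx _.
have : A * (1 - ep * p) <= A * expR (- (ep * p)) by rewrite ler_wpM2l // ltW.
have E : ep * (2 * (A * p) + 1) = A - B by rewrite divfK // gt_eqF.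
have := mulr_ge0 (ltW ep0) (mulr_ge0 (ltW A0) p0).
lra.
Qed.

(** The square root maps the first quadrant onto the sector 0 <= Im w <= Re
    w, by the half-angle formulas. *)
Lemma csqrt_quadrant z : 0 <= complex.Re z -> 0 <= complex.Im z ->
  exists2 w, z = w ^+ 2 & 0 <= complex.Im w <= complex.Re w.
Proof.
move=> a0 b0; have m0 := modulus_ge0 z; have m2 := modulus_sqr z.
have ma : complex.Re z <= modulus z := le_trans (ler_norm _) (Re_le_modulus z).
move: a0 b0 m0 m2 ma; case: z => a b; move: (modulus _) => m /= a0 b0 m0 m2 ma.
exists (Complex (Num.sqrt ((m + a) / 2)) (Num.sqrt ((m - a) / 2))).
  apply: complex_eq; rewrite expr2 ?cReM ?cImM /=.
    by rewrite -!expr2 !sqr_sqrtr; [by field|by lra..].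
  rewrite (mulrC (Num.sqrt ((m - a) / 2))) -sqrtrM; last lra.
  rewrite (_ : (m + a) / 2 * ((m - a) / 2) = (b / 2) ^+ 2).
    rewrite sqrtr_sqr ger0_norm; [by field|by lra].
  have -> : (m + a) / 2 * ((m - a) / 2) = (m ^+ 2 - a ^+ 2) / 4 by field.
  by rewrite m2; field.
by rewrite /= sqrtr_ge0 ler_wsqrtr //; lra.
Qed.

(** A function of exponential growth on a quadrant that is bounded on both
    sides is bounded by the same constant inside. In the variable w with z =
    w^2 the growth has order 2 and the domain is a sector of opening pi/4;
    there the factor exp(- ep kap w^3) decays like exp(- ep (Re w)^3) and
    beats the growth, so that the maximum principle on large triangles
    applies. Working with w keeps the auxiliary function free of fractional
    powers. *)
Lemma PL_quadrant F (C tau B : R) : 0 < B -> 0 <= tau ->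
  (forall z, differentiable F z) ->
  (forall z, modulus (F z) <= C * expR (tau * modulus z)) ->
  (forall x : R, 0 <= x -> modulus (F (x%:C)%C) <= B) ->
  (forall y : R, 0 <= y -> modulus (F (0 +i* y)%C) <= B) ->
  forall z, 0 <= complex.Re z -> 0 <= complex.Im z -> modulus (F z) <= B.
Proof.
move=> B0 tau0 Fd FC Fx Fy z z1 z2.
have C0 : 0 <= C.
  by have := le_trans (modulus_ge0 _) (FC 0); rewrite modulus0 mulr0 expR0 mulr1.
have [w0 -> /andP[w0y w0x]] := csqrt_quadrant z1 z2.
(* As w runs through the sector, arg (w^3) runs from 0 to 3 pi/4; the
   direction 1 + 2i, the conjugate of kap, makes an angle less than pi/2 with
   all of these. *)
pose kap : Cplx R := Complex 1 (-2).
pose p w := complex.Re (kap * w ^+ 3).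
have pge w : 0 <= complex.Im w -> complex.Im w <= complex.Re w -> complex.Re w ^+ 3 <= p w.
  rewrite /p. rewrite !(exprS w) expr0 mulr1. rewrite !cReM !cImM; case: w => x y /= y0 yx.
  have x0 : 0 <= x := le_trans y0 yx.
  rewrite -subr_ge0.
  rewrite [leRHS](_ : _ = y * (3 * x * (x - y) + (x - y) * (x + y) * 2 + x ^+ 2)); last by ring.
  apply: mulr_ge0 => //; have d0 : 0 <= x - y by rewrite subr_ge0.
  by rewrite !addr_ge0 ?sqr_ge0 // !mulr_ge0 // addr_ge0.
have p0 w : 0 <= complex.Im w -> complex.Im w <= complex.Re w -> 0 <= p w.
  move=> y0 yx; apply: le_trans (pge _ y0 yx); apply: exprn_ge0; exact: le_trans yx.
apply: (@le_expR_eps _ _ (p w0)) => [|ep ep0]; first exact: p0.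
pose c : Cplx R := ((- ep)%:C)%C.
pose H w := F (w ^+ 2) * cexp (c * (kap * w ^+ 3)).
have HE w : modulus (H w) = modulus (F (w ^+ 2)) * expR (- (ep * p w)).
  by rewrite modulusM modulus_cexp cReM /= mul0r subr0 mulNr.
suff : modulus (H w0) <= B.
  by rewrite HE expRN ler_pdivrMr ?expR_gt0.
(* On the side Re w = T the exponent is at most 2 tau T^2 - ep T^3 <= - T,
   and C exp(- T) <= B. *)
pose T := Num.max (Num.max (complex.Re w0) ((2 * tau + 1) / ep)) (Num.max 1 (C / B)).
have T1 : complex.Re w0 <= T by rewrite !le_max lexx.
have T2 : 2 * tau + 1 <= T * ep by rewrite -ler_pdivrMr // !le_max lexx orbT.
have T3 : 1 <= T by rewrite !le_max lexx !orbT.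
have T4 : C <= T * B by rewrite -ler_pdivrMr // !le_max lexx !orbT.
pose D : set (Cplx R) := [set w | 0 <= 0 * complex.Re w + 1 * complex.Im w] `&`
  [set w | 0 <= 1 * complex.Re w + (-1) * complex.Im w] `&`
  [set w | - T <= (-1) * complex.Re w + 0 * complex.Im w].
have DE w : D w <-> [/\ 0 <= complex.Im w, complex.Im w <= complex.Re w & complex.Re w <= T].
  rewrite /D /= !mul0r !mul1r !mulN1r add0r addr0 subr_ge0 lerN2.
  by split=> [[[]]|[]].
pose Bd : set (Cplx R) := [set w |
  [\/ complex.Im w = 0, complex.Im w = complex.Re w | complex.Re w = T]].
have cD : closed D by apply: closedI; [apply: closedI|]; exact: closed_halfplane.
have dpow n z0 : differentiable (fun w : Cplx R => w ^+ n) z0.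
  elim: n => [|n IH].
    rewrite (_ : (fun w => _) = cst 1); first exact: differentiable_cst.
    by apply/funext => w; rewrite expr0.
  rewrite (_ : (fun w => _) = (fun w => w * w ^+ n)); last first.
    by apply/funext => w; rewrite exprS.
  by apply: differentiableM => //; exact: differentiable_idC.
apply: (@maximum_modulus _ D Bd H B (2 * T) cD) => [w|w _|w|w|].
- move=> /DE[y0 yx xT]; apply: le_trans (modulus_le_ReIm _) _.
  by rewrite !ger0_norm //; lra.
- apply: differentiableM.
    exact: (@differentiable_comp _ _ _ _ (fun w => w ^+ 2) F).
  apply: (@differentiable_comp _ _ _ _ (fun w => c * (kap * w ^+ 3)) (@cexp R)).
    by do 2! apply: differentiableM => //.
  exact: differentiable_cexp.
- move=> /DE[y0 yx xT].
  have [y0'|y0'] := eqVneq (complex.Im w) 0; first by left; constructor 1.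
  have [yx'|yx'] := eqVneq (complex.Im w) (complex.Re w); first by left; constructor 2.
  have [xT'|xT'] := eqVneq (complex.Re w) T; first by left; constructor 3.
  have {}y0 : 0 < complex.Im w by rewrite lt_def y0'.
  have {}yx : complex.Im w < complex.Re w by rewrite lt_def eq_sym yx'.
  have {}xT : complex.Re w < T by rewrite lt_def eq_sym xT'.
  right; exists (Num.min (complex.Im w)
      (Num.min ((complex.Re w - complex.Im w) / 2) (T - complex.Re w))).
    by rewrite !lt_min y0 divr_gt0 ?subr_gt0.
  move=> v; rewrite !le_min => /and3P[h1 h2 h3]; apply/DE.
  have := Re_le_modulus (v - w); have := Im_le_modulus (v - w).
  rewrite !ReImE !ler_norml => /andP[i1 i2] /andP[j1 j2]; split; lra.
- move=> /DE[y0 yx xT]; rewrite HE.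
  have e1 : expR (- (ep * p w)) <= 1.
    by rewrite -expR0 ler_expR oppr_le0 mulr_ge0 ?p0 // ltW.
  have {}e1 : modulus (F (w ^+ 2)) <= B -> modulus (F (w ^+ 2)) * expR (- (ep * p w)) <= B.
    by move=> h; rewrite -[leRHS]mulr1 ler_pM ?modulus_ge0 ?expR_ge0.
  case=> [yE|yE|xE].
  + apply: e1; have -> : w ^+ 2 = ((complex.Re w ^+ 2)%:C)%C.
      apply: complex_eq; rewrite expr2 ?cReM ?cImM yE /=; ring.
    by apply: Fx; exact: sqr_ge0.
  + apply: e1; have -> : w ^+ 2 = Complex 0 (2 * complex.Re w ^+ 2).
      apply: complex_eq; rewrite expr2 ?cReM ?cImM yE /=; ring.
    by apply: Fy; rewrite mulr_ge0 // sqr_ge0.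
  + have := pge _ y0 yx; rewrite xE => pT.
    apply: (@le_trans _ _ (C * expR (tau * (2 * T ^+ 2)) * expR (- (ep * T ^+ 3)))).
      apply: ler_pM; rewrite ?modulus_ge0 ?expR_ge0 //.
        apply: le_trans (FC _) _; rewrite ler_wpM2l // ler_expR ler_wpM2l // modulusX modulus_sqr xE.
        have : complex.Im w ^+ 2 <= T ^+ 2 by rewrite ler_pXn2r ?nnegrE //; lra.
        lra.
      by rewrite ler_expR lerN2 ler_wpM2l // ltW.
    rewrite -mulrA -expRD.
    apply: (@le_trans _ _ (C * expR (- T))).
      rewrite ler_wpM2l // ler_expR.
      rewrite [leLHS](_ : _ = - (T * T * (T * ep - 2 * tau))); last by ring.
      rewrite lerN2 -[leLHS]mulr1 -mulrA ler_wpM2l //; first lra.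
      by apply: mulr_ege1 => //; lra.
    rewrite expRN ler_pdivrMr ?expR_gt0 // (le_trans T4) // mulrC ler_wpM2l ?(ltW B0) //.
    by have := expR_ge1Dx T; lra.
- by apply/DE.
Qed.

(** A bounded function on the upper half-plane does not exceed its bound on
    the real line. Division by 1 - i ep z, of modulus at least 1 on the
    half-plane, makes it small on the far sides of a large rectangle. *)
Lemma PL_halfplane_bounded F (B S : R) : 0 < S ->
  (forall z, 0 <= complex.Im z -> differentiable F z) ->
  (forall z, 0 <= complex.Im z -> modulus (F z) <= B) ->
  (forall x : R, modulus (F (x%:C)%C) <= S) ->
  forall z, 0 <= complex.Im z -> modulus (F z) <= S.
Proof.
move=> S0 Fd FB FS z0 z00.
have B0 : 0 <= B := le_trans (modulus_ge0 _) (FB _ z00).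
suff H ep : 0 < ep -> modulus (F z0) <= S * expR (ep * modulus z0).
  exact: le_expR_eps (modulus_ge0 z0) H.
move=> ep0.
pose q z : Cplx R := 1 + Complex 0 (- ep) * z.
have q1 z : 0 <= complex.Im z -> 1 + ep * complex.Im z <= modulus (q z).
  move=> y0; apply: le_trans (Re_le_modulus _); rewrite !ReImE /=.
  by rewrite mul0r sub0r mulNr opprK ler_norm.
have q2 z : ep * `|complex.Re z| <= modulus (q z).
  apply: le_trans (Im_le_modulus _); rewrite !ReImE /=.
  by rewrite mul0r !add0r normrM normrN (gtr0_norm ep0).
have q3 : modulus (q z0) <= expR (ep * modulus z0).
  apply: le_trans (expR_ge1Dx _).
  apply: le_trans (modulusD _ _) _; rewrite modulus1 lerD2l modulusM.
  by rewrite /modulus /= expr0n add0r sqrtr_sqr normrN gtr0_norm.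
have q0 z : 0 <= complex.Im z -> 0 < modulus (q z).
  move=> y0; apply: lt_le_trans (q1 _ y0).
  by have := mulr_ge0 (ltW ep0) y0; lra.
(* On the far sides |q| >= ep T, which exceeds B / S. *)
pose T := modulus z0 + B / (S * ep) + 1.
have zT : modulus z0 < T by rewrite /T -addrA ltrDl ltr_wpDl // divr_ge0 // mulr_ge0 // ltW.
have BT : B <= S * (ep * T).
  rewrite mulrA mulrC -ler_pdivrMr ?mulr_gt0 // /T -addrA addrCA lerDl.
  by rewrite addr_ge0 // modulus_ge0.
pose D : set (Cplx R) := [set w | - T <= (-1) * complex.Re w + 0 * complex.Im w] `&`
  [set w | - T <= 1 * complex.Re w + 0 * complex.Im w] `&`
  [set w | - T <= 0 * complex.Re w + (-1) * complex.Im w] `&`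
  [set w | 0 <= 0 * complex.Re w + 1 * complex.Im w].
have DE w : D w <-> [/\ `|complex.Re w| <= T, 0 <= complex.Im w & complex.Im w <= T].
  rewrite /D /= !mul0r !mul1r !mulN1r !add0r !addr0 !lerN2 ler_norml.
  by split=> [[[[-> ->] ->] ->]|[/andP[-> ->] -> ->]].
pose Bd : set (Cplx R) := [set w | [\/ complex.Im w = 0, complex.Im w = T | `|complex.Re w| = T]].
have cD : closed D by repeat (apply: closedI; last exact: closed_halfplane); exact: closed_halfplane.
suff : modulus (F z0 / q z0) <= S.
  rewrite modulusM modulusV ler_pdivrMr ?q0 // => /le_trans; apply.
  by rewrite ler_wpM2l // ltW.
apply: (@maximum_modulus _ D Bd (fun z => F z / q z) S (2 * T) cD) => [w|w|w|w|].
- move=> /DE[xT y0 yT]; apply: le_trans (modulus_le_ReIm _) _.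
  by rewrite (ger0_norm y0); lra.
- move=> /DE[xT y0 yT]; apply: differentiableM; first exact: Fd.
  apply: differentiableV; last by rewrite -modulus_gt0 q0.
  exact: (@differentiable_affine _ (fun w => w) w 1 _ (differentiable_idC _)).
- move=> /DE[xT y0 yT].
  have [y0'|y0'] := eqVneq (complex.Im w) 0; first by left; constructor 1.
  have [yT'|yT'] := eqVneq (complex.Im w) T; first by left; constructor 2.
  have [xT'|xT'] := eqVneq `|complex.Re w| T; first by left; constructor 3.
  have {}y0 : 0 < complex.Im w by rewrite lt_def y0'.
  have {}yT : complex.Im w < T by rewrite lt_def eq_sym yT'.
  have {}xT : `|complex.Re w| < T by rewrite lt_def eq_sym xT'.
  right; exists (Num.min (complex.Im w) (Num.min (T - complex.Im w) (T - `|complex.Re w|))).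
    by rewrite !lt_min y0 !subr_gt0 yT.
  move=> v; rewrite !le_min => /and3P[h1 h2 h3]; apply/DE.
  have := Re_le_modulus (v - w); have := Im_le_modulus (v - w).
  rewrite !ReImE => /[dup]; rewrite {1}ler_norml => /andP[i1 i2] i3 j1.
  have j2 := ler_normB (complex.Re v - complex.Re w) (- complex.Re w).
  rewrite opprK subrK normrN in j2.
  split; lra.
- move=> /DE[xT y0 yT] wB; rewrite modulusM modulusV ler_pdivrMr ?q0 //.
  have far : ep * T <= modulus (q w) -> modulus (F w) <= S * modulus (q w).
    move=> h; apply: le_trans (FB _ y0) _; apply: le_trans BT _.
    by rewrite ler_wpM2l // ltW.
  case: wB => [yE|yE|xE].
  + have -> : w = ((complex.Re w)%:C)%C by apply: complex_eq.
    apply: le_trans (FS _) _; rewrite ler_peMr ?(ltW S0) //.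
    by apply: le_trans (q1 _ _); rewrite /= ?mulr0 ?addr0.
  + by apply: far; apply: le_trans (q1 _ y0); rewrite yE lerDr.
  + by apply: far; rewrite -xE.
- apply/DE; split=> //; apply: le_trans (ltW zT).
    exact: Re_le_modulus.
  by apply: le_trans (ler_norm _) _; exact: Im_le_modulus.
Qed.

(** Multiplication by exp(i tau z) leaves the modulus unchanged on the real
    line and makes the function bounded on the positive imaginary axis;
    PL_quadrant, applied to the two quadrants, makes it bounded on the half-
    plane, and PL_halfplane_bounded improves the bound to S. *)
Lemma PL_upper g (C tau S : R) : 0 < S -> 0 <= tau ->
  (forall z, differentiable g z) ->
  (forall z, modulus (g z) <= C * expR (tau * modulus z)) ->
  (forall x : R, modulus (g (x%:C)%C) <= S) ->
  forall z, 0 <= complex.Im z -> modulus (g z) <= S * expR (tau * complex.Im z).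
Proof.
move=> S0 tau0 gd gC gS.
have C0 : 0 <= C.
  by have := le_trans (modulus_ge0 _) (gC 0); rewrite modulus0 mulr0 expR0 mulr1.
pose c : Cplx R := Complex 0 tau.
pose h z := g z * cexp (c * z).
have hE z : modulus (h z) = modulus (g z) * expR (- (tau * complex.Im z)).
  by rewrite modulusM modulus_cexp cReM /= mul0r sub0r.
have hd z : differentiable h z.
  apply: differentiableM; first exact: gd.
  exact: has_cderiv_diff (has_cderiv_cexpZ c z).
have hC z : modulus (h z) <= C * expR (2 * tau * modulus z).
  rewrite hE; apply: (@le_trans _ _ (C * expR (tau * modulus z) * expR (tau * modulus z))).
    apply: ler_pM; rewrite ?modulus_ge0 ?expR_ge0 // ler_expR -mulrN ler_wpM2l //.
    by apply: le_trans (Im_le_modulus z); rewrite -normrN ler_norm.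
  by rewrite -mulrA -expRD ler_wpM2l // ler_expR; lra.
have hreal (x : R) : modulus (h (x%:C)%C) <= S.
  by rewrite hE /= mulr0 oppr0 expR0 mulr1.
pose B := Num.max S C.
have SB : S <= B by rewrite le_max lexx.
have B0 : 0 < B := lt_le_trans S0 SB.
have himag (y : R) : 0 <= y -> modulus (h (0 +i* y)%C) <= B.
  move=> y0; rewrite hE /= expRN ler_pdivrMr ?expR_gt0 //.
  apply: le_trans (gC _) _.
  have -> : modulus (0 +i* y)%C = y by rewrite /modulus /= expr0n add0r sqrtr_sqr ger0_norm.
  by rewrite ler_wpM2r ?expR_ge0 // le_max lexx orbT.
have t20 : 0 <= 2 * tau by rewrite mulr_ge0.
have hB z : 0 <= complex.Im z -> modulus (h z) <= B.
  move=> y0; have [x0|x0] := leP 0 (complex.Re z).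
    apply: (PL_quadrant B0 t20 hd hC) => // x _; exact: le_trans SB.
  (* The second quadrant is i times the first. *)
  pose h2 z := h (0 + (0 +i* 1)%C * z).
  have zE : z = 0 + (0 +i* 1)%C * (Complex (complex.Im z) (- complex.Re z)).
    by apply: complex_eq; rewrite !ReImE /=; ring.
  have h2d w : differentiable h2 w by apply: differentiable_affine.
  have h2C w : modulus (h2 w) <= C * expR (2 * tau * modulus w).
    apply: le_trans (hC _) _.
    by rewrite add0r modulusM /modulus /= expr0n expr1n add0r sqrtr1 mul1r.
  rewrite [z in h z]zE; apply: (PL_quadrant B0 t20 h2d h2C).
  - move=> x x0'; rewrite /h2 (_ : 0 + _ = Complex 0 x) ?himag //.
    by apply: complex_eq; rewrite !ReImE /=; ring.
  - move=> y y0'; rewrite /h2 (_ : 0 + _ = ((- y)%:C)%C) ?(le_trans (hreal _)) //.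
    by apply: complex_eq; rewrite !ReImE /=; ring.
  - exact: y0.
  - by rewrite /= oppr_ge0 ltW.
move=> z y0.
have := @PL_halfplane_bounded h B S S0 (fun z _ => hd z) hB hreal z y0.
by rewrite hE expRN ler_pdivrMr ?expR_gt0.
Qed.

Theorem phragmen_lindelof g (C tau S : R) : 0 < S -> 0 <= tau ->
  (forall z, differentiable g z) ->
  (forall z, modulus (g z) <= C * expR (tau * modulus z)) ->
  (forall x : R, modulus (g (x%:C)%C) <= S) ->
  forall z, modulus (g z) <= S * expR (tau * `|complex.Im z|).
Proof.
move=> S0 tau0 gd gC gS z.
have [y0|y0] := leP 0 (complex.Im z).
  by rewrite (ger0_norm y0); exact: (PL_upper S0 tau0 gd gC gS).
pose g2 z := g (0 + (-1) * z).
have -> : g z = g2 (- z) by rewrite /g2 add0r mulN1r opprK.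
rewrite (ltr0_norm y0); have /= := @PL_upper g2 C tau S S0 tau0 _ _ _ (- z); rewrite cImN; apply.
- by move=> w; apply: differentiable_affine.
- by move=> w; rewrite /g2 add0r mulN1r; have := gC (- w); rewrite modulusN.
- move=> x; rewrite /g2 add0r mulN1r (_ : - _ = ((- x)%:C)%C) ?gS //.
  by apply: complex_eq; rewrite ?cReN ?cImN /= ?oppr0.
- by rewrite oppr_ge0 ltW.
Qed.

End PhragmenLindelof.

(** * The Bernstein-Szego inequality on the line *)
Section BernsteinSzego1D.
Context {R : realType}.
Implicit Types (z w : Cplx R) (F g : Cplx R -> Cplx R).

(** The half-plane comparison behind the inequality. As lam dominates S, the
    function Phi has no zero in the closed upper half-plane, where it is at
    least (|lam| - S) exp(sg Im z), while the reflected function is at most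
    (|lam| + S) exp(sg Im z). Their quotient is therefore bounded; it has
    modulus 1 on the real line, hence modulus at most 1 on the half-plane. *)
Lemma comparison_reflect g (sg S : R) (lam : Cplx R) :
  0 < S -> 0 <= sg -> S < modulus lam ->
  (forall z, differentiable g z) ->
  (forall z, modulus (g z) <= S * expR (sg * `|complex.Im z|)) ->
  let Phi z := lam * cexp (Complex 0 (- sg) * z) - g z in
  forall z, 0 <= complex.Im z -> modulus (Phi (cconj z)) <= modulus (Phi z).
Proof.
move=> S0 sg0 Sl gd gS Phi.
have PhiE z : modulus (lam * cexp (Complex 0 (- sg) * z)) = modulus lam * expR (sg * complex.Im z).
  by rewrite modulusM modulus_cexp cReM /= mul0r mulNr opprK add0r.
have Phid z : differentiable Phi z.
  apply: differentiableB; last exact: gd.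
  apply: differentiableM; first exact: differentiable_cst.
  exact: has_cderiv_diff (has_cderiv_cexpZ _ z).
have lb z : 0 <= complex.Im z -> (modulus lam - S) * expR (sg * complex.Im z) <= modulus (Phi z).
  move=> y0; apply: le_trans (modulus_lerB _ _); rewrite PhiE.
  by have := gS z; rewrite (ger0_norm y0); lra.
have ub z : 0 <= complex.Im z ->
    modulus (Phi (cconj z)) <= (modulus lam + S) * expR (sg * complex.Im z).
  move=> y0; apply: le_trans (modulusB _ _) _; rewrite PhiE.
  have Imc : complex.Im (cconj z) = - complex.Im z by case: (z).
  have := gS (cconj z); rewrite Imc normrN (ger0_norm y0) mulrDl => H.
  apply: lerD => //; rewrite ler_wpM2l ?modulus_ge0 // ler_expR ler_wpM2l //.
  lra.
have dl0 : 0 < modulus lam - S by rewrite subr_gt0.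
have Phi0 z : 0 <= complex.Im z -> 0 < modulus (Phi z).
  by move=> y0; apply: lt_le_trans (lb z y0); rewrite mulr_gt0 ?expR_gt0.
pose Q z := cconj (Phi (cconj z)) / Phi z.
have QE z : modulus (Q z) = modulus (Phi (cconj z)) / modulus (Phi z).
  by rewrite modulusM modulusV modulusJ.
move=> z y0;
have := @PL_halfplane_bounded _ Q ((modulus lam + S) / (modulus lam - S)) 1 ltr01 _ _ _ z y0.
rewrite QE ler_pdivrMr ?Phi0 // mul1r; apply.
- move=> w w0; apply: differentiableM.
    exact: differentiable_conj.
  by apply: differentiableV => //; rewrite -modulus_gt0 Phi0.
- move=> w w0; rewrite QE ler_pdivrMr ?Phi0 // mulrAC ler_pdivlMr //.
  apply: (@le_trans _ _ ((modulus lam + S) * expR (sg * complex.Im w) * (modulus lam - S))).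
    by rewrite ler_wpM2r ?ub // ltW.
  rewrite -mulrA ler_wpM2l //; last by rewrite mulrC lb.
  by rewrite addr_ge0 ?modulus_ge0 // ltW.
- move=> x; have -> : Q (x%:C)%C = cconj (Phi (x%:C)%C) / Phi (x%:C)%C.
    rewrite /Q; congr (cconj (Phi _) / _).
    by apply: complex_eq; rewrite /= ?oppr0.
  by rewrite modulusM modulusV modulusJ divff // gt_eqF // Phi0.
Qed.

(** The difference |F(iy)|^2 - |F(-iy)|^2 vanishes at y = 0 and has there
    the derivative 4 Re (conj (F 0) i d). *)
Lemma has_cderiv_reflect_ge0 F d : has_cderiv F 0 d ->
  (forall y : R, 0 < y -> modulus (F (Complex 0 (- y))) <= modulus (F (Complex 0 y))) ->
  0 <= complex.Re (cconj (F 0) * (Complex 0 1 * d)).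
Proof.
move=> Fd Fy; set A := F 0; set Bv : Cplx R := Complex 0 1 * d.
rewrite leNgt; apply/negP => neg.
set r := complex.Re _ in neg.
have k0 : 0 < modulus A + modulus Bv + 1.
  by have := modulus_ge0 A; have := modulus_ge0 Bv; lra.
(* To first order F(+-iy) = A +- y Bv; for negative r the gain 4 y |r|
   outweighs an error of e y in each value. *)
pose e := - r / (2 * (modulus A + modulus Bv + 1)).
have e0 : 0 < e by rewrite divr_gt0 ?oppr_gt0 // mulr_gt0.
have [q q0 qP] := Fd _ e0.
pose y := Num.min 1 (q / 2).
have y0 : 0 < y by rewrite lt_min ltr01 divr_gt0.
have y1 : y <= 1 by rewrite ge_min lexx.
have yq : y < q.
  apply: (@le_lt_trans _ _ (q / 2)); [by rewrite ge_min lexx orbT|].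
  by rewrite ltr_pdivrMr // ltr_pMr // ltr1n.
have mi (t : R) : modulus (Complex 0 t) = `|t| by rewrite /modulus /= expr0n add0r sqrtr_sqr.
have H t : `|t| = y -> modulus (F (Complex 0 t) - (A + (t%:C)%C * Bv)) <= e * y.
  move=> ty; have := qP (Complex 0 t); rewrite mi ty add0r => /(_ yq).
  have -> : F (Complex 0 t) - F 0 - d * Complex 0 t = F (Complex 0 t) - (A + (t%:C)%C * Bv).
    rewrite /A /Bv (_ : d * Complex 0 t = (t%:C)%C * (Complex 0 1 * d)); first by ring.
    by apply: complex_eq; rewrite !ReImE /=; ring.
  by [].
have H1 := H y (gtr0_norm y0).
have H2 : modulus (F (Complex 0 (- y)) - (A - (y%:C)%C * Bv)) <= e * y.
  have := H (- y); rewrite normrN => /(_ (gtr0_norm y0)).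
  suff -> : ((- y)%:C)%C * Bv = - ((y%:C)%C * Bv) by [].
  by apply: complex_eq; rewrite !ReImE /=; ring.
have {}Fy := Fy _ y0.
set P := modulus (A + (y%:C)%C * Bv); set N := modulus (A - (y%:C)%C * Bv).
have PN : N <= P + 2 * (e * y).
  have := modulus_lerB (F (Complex 0 y)) (A + (y%:C)%C * Bv); rewrite -/P.
  have := modulus_lerB (A - (y%:C)%C * Bv) (F (Complex 0 (- y))); rewrite modulusBC -/N.
  lra.
have sq : P ^+ 2 - N ^+ 2 = 4 * (y * r).
  rewrite /P /N !modulus_sqr /r; case: (A) => a b; case: (Bv) => a' b' /=.
  by rewrite !mul0r !subr0 !addr0 /=; ring.
have yBv : modulus ((y%:C)%C * Bv) <= modulus Bv.
  by rewrite modulusM modulus_real gtr0_norm // ler_piMl // modulus_ge0.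
have P1 : P <= modulus A + modulus Bv.
  by apply: le_trans (modulusD _ _) _; rewrite lerD2l.
have N1 : N <= modulus A + modulus Bv.
  by apply: le_trans (modulusB _ _) _; rewrite lerD2l.
have PN0 : 0 <= N + P by rewrite addr_ge0 ?modulus_ge0.
have ey0 : 0 < e * y by rewrite mulr_gt0.
have h1 : (N - P) * (N + P) <= 2 * (e * y) * (N + P).
  by rewrite ler_wpM2r //; lra.
have h2 : 2 * (e * y) * (N + P) <= 2 * (e * y) * (2 * (modulus A + modulus Bv)).
  by rewrite ler_wpM2l //; lra.
have ek : e * (2 * (modulus A + modulus Bv + 1)) = - r by rewrite divfK // gt_eqF // mulr_gt0.
have h3 : (N - P) * (N + P) = - (4 * (y * r)) by rewrite -sq; ring.
have h4 : 4 * (y * - r) <= 2 * y * (e * (2 * (modulus A + modulus Bv + 1))) - 4 * (e * y) by lra.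
rewrite ek in h4.
have : 0 < y * - r by rewrite mulr_gt0 // oppr_gt0.
lra.
Qed.

(** The open disc of radius |q| about p contains no point outside the closed
    disc of radius S about 0. Unless p itself lies outside, which would
    force q = 0 and |p| = |p + q| <= S, this means that the first disc is
    contained in the second. *)
Lemma modulus_add_le (S : R) (p q : Cplx R) : 0 <= S ->
  modulus (p + q) <= S ->
  (forall lam, S < modulus lam -> modulus q <= modulus (lam - p)) ->
  modulus p + modulus q <= S.
Proof.
move=> S0 pqS H; have [pS|Sp] := leP (modulus p) S; last first.
  have := H _ Sp; rewrite subrr modulus0 => q0.
  have /eqP : modulus q = 0 by apply/le_anti; rewrite q0 modulus_ge0.
  by rewrite modulus_eq0 => /eqP qE; move: pqS; rewrite qE addr0 leNgt Sp.
apply/ler_addgt0Pr => e e0.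
(* The point (S + e) u of the exterior, in the direction u of p, is at
   distance S + e - |p| from p. *)
have Se : 0 < S + e by rewrite ltr_wpDl.
suff [u u1 pu] : exists2 u : Cplx R, modulus u = 1 & p = ((modulus p)%:C)%C * u.
  have := H (((S + e)%:C)%C * u).
  rewrite modulusM u1 mulr1 modulus_real gtr0_norm // ltrDl => /(_ e0).
  have -> : ((S + e)%:C)%C * u - p = ((S + e - modulus p)%:C)%C * u.
    by rewrite {1}pu -mulrBl -rmorphB.
  rewrite modulusM u1 mulr1 modulus_real ger0_norm; lra.
have [->|p0] := eqVneq p 0.
  by exists 1; rewrite ?modulus1 // modulus0 mulr1.
exists (p / ((modulus p)%:C)%C).
  by rewrite modulusM modulusV modulus_real ger0_norm ?modulus_ge0 // divff // modulus_eq0.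
rewrite mulrC divfK // -modulus_eq0 modulus_real ger0_norm ?modulus_ge0 //.
by rewrite modulus_eq0.
Qed.

Lemma Re_reflect (a q : Cplx R) (sg : R) :
  complex.Re (cconj (a - q) * (((sg%:C)%C : Cplx R) * (a + q))) =
  sg * (modulus a ^+ 2 - modulus q ^+ 2).
Proof. by rewrite !modulus_sqr; case: a => a1 a2; case: q => q1 q2 /=; ring. Qed.

(** With g(0) = p + q and i g'(0) = sg (p - q), the sign condition given by
    has_cderiv_reflect_ge0 for Phi = lam exp(- i sg z) - g reads |lam - p|
    >= |q|. It holds for all |lam| > S, so |p| + |q| <= S; and the left-hand
    side is sg times the modulus of exp(i alpha) p + exp(- i alpha) q. *)
Theorem bernstein_szego_line g (C sg S alpha : R) (g1 : Cplx R) : 0 < sg ->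
  (forall z, differentiable g z) ->
  (forall z, modulus (g z) <= C * expR (sg * modulus z)) ->
  (forall x : R, modulus (g (x%:C)%C) <= S) ->
  has_cderiv g 0 g1 ->
  modulus (((sin alpha)%:C)%C * g1 - ((sg * cos alpha)%:C)%C * g 0) <= sg * S.
Proof.
move=> sg0 gd gC gS gg1.
have S0 : 0 <= S := le_trans (modulus_ge0 _) (gS 0).
pose sgC : Cplx R := (sg%:C)%C.
have sgC0 : sgC != 0 by rewrite -modulus_eq0 modulus_real gt_eqF // gtr0_norm.
pose I : Cplx R := Complex 0 1.
have II : I * I = -1 by apply: complex_eq; rewrite ?cReM ?cImM ?cReN ?cImN /=; ring.
pose w := g1 / sgC.
have g1E : g1 = sgC * w by rewrite /w mulrC divfK.
pose p := (g 0 + I * w) / 2; pose q := (g 0 - I * w) / 2.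
have g0E : g 0 = p + q by rewrite /p /q; field.
have IwE : I * w = p - q by rewrite /p /q; field.
clearbody p q.
have pq : modulus p + modulus q <= S.
  apply: modulus_add_le => //; first by rewrite -g0E; exact: gS 0.
  (* The comparison needs a positive bound of g on the line strictly below
     |lam|. *)
  move=> lam Sl; pose S' := (S + modulus lam) / 2.
  have S'0 : 0 < S' by rewrite /S'; have := modulus_ge0 lam; lra.
  have SS' : S <= S' by rewrite /S'; lra.
  have S'l : S' < modulus lam by rewrite /S'; lra.
  have gS' := @phragmen_lindelof _ g C sg S' S'0 (ltW sg0) gd gC
     (fun x => le_trans (gS x) SS').
  have refl := comparison_reflect S'0 (ltW sg0) S'l gd gS'.
  pose c : Cplx R := Complex 0 (- sg).
  pose Phi z := lam * cexp (c * z) - g z.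
  have Phid : has_cderiv Phi 0 (lam * c - g1).
    have -> : lam * c - g1 = lam * (c * cexp (c * 0)) + (-1) * g1.
      by rewrite mulr0 cexp0 mulr1 mulN1r.
    rewrite (_ : Phi = fun z => lam * cexp (c * z) + (-1) * g z); last first.
      by apply/funext => z; rewrite mulN1r.
    by apply: has_cderivD; apply: has_cderivMl => //; exact: has_cderiv_cexpZ.
  have := has_cderiv_reflect_ge0 Phid.
  have Hy y : 0 < y -> modulus (Phi (0 +i* - y)%C) <= modulus (Phi (0 +i* y)%C).
    by move=> y0; exact: refl (Complex 0 y) (ltW y0).
  move=> /(_ Hy).
  have -> : Phi 0 = (lam - p) - q by rewrite /Phi mulr0 cexp0 mulr1 g0E; ring.
  have -> : (0 +i* 1)%C * (lam * c - g1) = sgC * ((lam - p) + q).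
    have -> : lam - p + q = lam - I * w by rewrite IwE; ring.
    rewrite g1E (_ : c = - (I * sgC)); last first.
      by apply: complex_eq; rewrite !ReImE /=; ring.
    rewrite -/I (_ : I * (lam * _ - _) = - (I * I) * sgC * lam - sgC * (I * w)); last by ring.
    by rewrite II; ring.
  move: (lam - p) => a H.
  have : 0 <= sg * (modulus a ^+ 2 - modulus q ^+ 2) by rewrite -Re_reflect.
  by rewrite pmulr_rge0 // subr_ge0 ler_pXn2r ?nnegrE ?modulus_ge0.
pose u : Cplx R := Complex (cos alpha) (sin alpha).
have u1 : modulus u = 1 by rewrite /modulus /= cos2Dsin2 sqrtr1.
have -> : ((sin alpha)%:C)%C * g1 - ((sg * cos alpha)%:C)%C * g 0 = - sgC * (u * p + cconj u * q).
  have wE : w = - (I * (p - q)) by rewrite -IwE mulrA II; ring.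
  rewrite g1E wE g0E /sgC /I; case: (p) => p1 p2; case: (q) => q1 q2.
  by apply: complex_eq; rewrite /=; ring.
rewrite modulusM modulusN modulus_real gtr0_norm // ler_wpM2l ?(ltW sg0) //.
apply: le_trans (modulusD _ _) _.
by rewrite !modulusM modulusJ u1 !mul1r.
Qed.

End BernsteinSzego1D.

(** * Convex bodies and their polars *)

Lemma differentiable_linear_form (F : numFieldType) (n : nat) (c : 'I_n -> F) (x : 'rV[F]_n) :
  differentiable (fun z : 'rV[F]_n => \sum_j c j * z 0 j) x.
Proof.
rewrite (_ : (fun z => _) = \sum_j (fun z : 'rV[F]_n => c j * z 0 j)); last first.
  by apply/funext => z; rewrite fct_sumE.
apply: differentiable_sum => j; apply: differentiableM.
  exact: differentiable_cst.
exact: differentiable_coord.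
Qed.

Section ConvexBodies.
Context {R : realType} {m : nat}.
Implicit Types (K V : set 'rV[R]_m) (t x y : 'rV[R]_m).

Lemma dotrC t y : dotr t y = dotr y t.
Proof. by apply: eq_bigr => j _; rewrite mulrC. Qed.

Lemma dotrZr t (c : R) y : dotr t (c *: y) = c * dotr t y.
Proof. by rewrite mulr_sumr; apply: eq_bigr => j _; rewrite mxE mulrCA. Qed.

Lemma dotrZl t (c : R) y : dotr (c *: t) y = c * dotr t y.
Proof. by rewrite dotrC dotrZr dotrC. Qed.

Lemma dotr0 t : dotr t 0 = 0.
Proof. by rewrite /dotr big1 // => j _; rewrite mxE mulr0. Qed.

Lemma dotr_self_gt0 x : x != 0 -> 0 < dotr x x.
Proof.
move=> x0; rewrite lt_def sumr_ge0 ?andbT; last by move=> j _; rewrite -expr2 sqr_ge0.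
apply: contra x0 => /eqP/psumr_eq0P H; apply/eqP/rowP => j; rewrite mxE.
have /eqP := H (fun j _ => (sqr_ge0 (x 0 j))) j isT.
by rewrite -expr2 sqrf_eq0 => /eqP.
Qed.

Lemma dotr_continuous t : continuous (dotr t).
Proof. move=> x; apply: differentiable_continuous; exact: differentiable_linear_form. Qed.

Lemma dotr_bound t y (L : R) : (forall j, `|t 0 j| <= L) ->
  `|dotr t y| <= L * \sum_j `|y 0 j|.
Proof.
move=> tL; apply: (le_trans (ler_norm_sum _ _ _)).
by rewrite mulr_sumr ler_sum // => j _; rewrite normrM ler_wpM2r.
Qed.

Lemma body_closed V : convex_body V -> closed V.
Proof. by case=> cV _ _; apply: compact_closed => //; exact: norm_hausdorff. Qed.

Lemma body_bounded V : convex_body V ->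
  exists2 L : R, 0 < L & forall t, V t -> forall j, `|t 0 j| <= L.
Proof.
case=> cV _ _.
have [M [Mreal HM]] := compact_bounded cV.
exists (Num.max 1 (M + 1)); first by rewrite lt_max ltr01.
move=> t Vt j; apply: (@le_trans _ _ (M + 1)); last by rewrite le_max lexx orbT.
apply: le_trans (HM (M + 1) _ t Vt); last by rewrite ltrDl.
have -> : `|t| = mx_norm t by []. rewrite mx_normrE.
exact: (le_bigmax _ (fun i : 'I_1 * 'I_m => `|t i.1 i.2|) (0, j)).
Qed.

Lemma nbhs_rVP x (P : set 'rV[R]_m) : nbhs x P <->
  exists2 r : R, 0 < r & forall y, (forall j, `|x 0 j - y 0 j| < r) -> P y.
Proof.
split=> [/nbhs_ballP[r /= r0 rP]|[r r0 rP]].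
  exists r => // y yr; apply: rP; split=> // i j.
  by rewrite (ord1 i); exact: yr.
apply/nbhs_ballP; exists r => // y [_ yr]; apply: rP => j; exact: yr.
Qed.

(** If the body contains a cube about c, then by symmetry it contains one
    about - c, and the midpoints of corresponding points fill the cube about
    0. *)
Lemma body_ball V : convex_body V -> origin_symmetric V ->
  exists2 r : R, 0 < r & forall x, (forall j, `|x 0 j| < r) -> V x.
Proof.
move=> [_ cV [c cint]] sV; have /nbhs_rVP[r r0 rV] : nbhs c V := cint; exists r => // x xr.
have V1 : V (c + x).
  by apply: rV => j; rewrite mxE opprD addrA subrr add0r normrN.
have V2 : V (x - c).
  rewrite -opprB; apply: sV; apply: rV => j.
  by rewrite !mxE opprB addrCA subrr addr0.
have h0 : 0 <= 2^-1 :> R by rewrite invr_ge0.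
have h1 : 2^-1 <= 1 :> R by rewrite invf_le1 // ler1n.
have H := cV (c + x) (x - c) (Itv01 h0 h1) (mem_set V1) (mem_set V2).
have := set_mem H.
suff -> : conv (Itv01 h0 h1) (c + x : convex_lmodType 'rV[R]_m) (x - c) = x by [].
rewrite /conv /=; apply/rowP => j; rewrite !mxE /=. rewrite /unstable.onem; lra.
Qed.

Lemma body_nbhs0 V : convex_body V -> origin_symmetric V -> V° 0.
Proof.
move=> bV sV; have [r r0 rV] := body_ball bV sV.
apply/nbhs_rVP; exists r => // x xr; apply: rV => j.
by have := xr j; rewrite mxE sub0r normrN.
Qed.

Lemma polar_closed K : closed (polar K).
Proof.
have -> : polar K = \bigcap_(t in K) ((fun y => `|dotr t y|) @^-1` [set a | a <= 1]).
  by apply/seteqP; split.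
apply: closed_bigI => t _; apply: closed_comp; last exact: closed_le.
move=> y _; apply: (@continuous_comp _ _ _ (dotr t) Num.norm).
  exact: dotr_continuous.
exact: norm_continuous.
Qed.

Lemma polar0 K : polar K 0.
Proof. by move=> t _; rewrite dotr0 normr0. Qed.

(** A cube contained in K holds a multiple of every coordinate vector, and
    this bounds the coordinates of the points of the polar. *)
Lemma polar_bounded K : convex_body K -> origin_symmetric K ->
  exists2 L : R, 0 < L & forall t, polar K t -> forall j, `|t 0 j| <= L.
Proof.
move=> bK sK; have [r r0 rK] := body_ball bK sK.
exists (2 / r); first exact: divr_gt0.
move=> t tK j; pose e : 'rV[R]_m := \row_i (if i == j then r / 2 else 0).
have eK : K e.
  apply: rK => i; rewrite mxE; case: ifP => _; last by rewrite normr0.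
  by rewrite gtr0_norm ?divr_gt0 // ltr_pdivrMr // ltr_pMr // ltr1n.
have := tK _ eK.
have -> : dotr e t = r / 2 * t 0 j.
  rewrite /dotr (bigD1 j) //= mxE eqxx big1 ?addr0 // => i /negbTE ij.
  by rewrite mxE ij mul0r.
rewrite normrM gtr0_norm ?divr_gt0 // => H.
by rewrite ler_pdivlMr // mulrC; lra.
Qed.

Lemma polar_compact K : convex_body K -> origin_symmetric K -> compact (polar K).
Proof.
move=> bK sK; have [L L0 LK] := polar_bounded bK sK.
apply: (@subclosed_compact _ _ [set v : 'rV[R]_m | forall i, `[-L, L]%classic (v ord0 i)]).
- exact: polar_closed.
- apply: (@rV_compact R m (fun=> `[-L, L]%classic)) => i; exact: segment_compact.
- by move=> t tK j; rewrite /= in_itv /= -ler_norml LK.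
Qed.

Lemma body_norm_ub K x y : convex_body K -> origin_symmetric K -> polar K y ->
  `|dotr y x| <= body_norm K x.
Proof.
move=> bK sK yK; have [L L0 LK] := polar_bounded bK sK.
apply: ub_le_sup; last by exists y.
by exists (L * \sum_j `|x 0 j|) => _ [t tK <-]; exact: dotr_bound (LK t tK).
Qed.

Lemma body_norm_attained K x : convex_body K -> origin_symmetric K ->
  exists2 y, polar K y & `|dotr y x| = body_norm K x.
Proof.
move=> bK sK.
have [||y /set_mem yK ymax] := @EVT_max_rV _ _
  (fun y => `|dotr y x|) (polar K) _ (polar_compact bK sK).
- by exists 0; exact: polar0.
- apply: continuous_subspaceT => y.
  under eq_fun do rewrite dotrC.
  apply: (@continuous_comp _ _ _ (dotr x) Num.norm); last exact: norm_continuous.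
  exact: dotr_continuous.
exists y => //; apply/le_anti; rewrite body_norm_ub //=.
apply: ge_sup; first by exists `|dotr 0 x|, 0 => //; exact: polar0.
by move=> _ [t tK <-]; apply: ymax; exact: mem_set.
Qed.

(** Since K is bounded, a small multiple of x belongs to the polar. *)
Lemma body_norm_gt0 K x : convex_body K -> origin_symmetric K -> x != 0 ->
  0 < body_norm K x.
Proof.
move=> bK sK x0; have [L L0 LK] := body_bounded bK.
have xx := dotr_self_gt0 x0.
(* S bounds |(t,x)| over t in K, so that x / S lies in the polar. *)
pose S := L * \sum_j `|x 0 j| + 1.
have S0 : 0 < S by rewrite ltr_wpDl // mulr_ge0 ?(ltW L0) // sumr_ge0.
have xK : polar K (S^-1 *: x).
  move=> t tK; rewrite dotrZr normrM gtr0_norm ?invr_gt0 // mulrC ler_pdivrMr // mul1r.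
  by apply: le_trans (dotr_bound x (LK t tK)) _; rewrite lerDl.
apply: lt_le_trans (body_norm_ub x bK sK xK).
by rewrite dotrZl normr_gt0 gt_eqF // mulr_gt0 // invr_gt0.
Qed.

(** The reason why M(K,V) is the exponential type in a direction y of the
    polar: for t in V, |(t,y)| <= ||t||_K <= M(K,V). *)
Lemma dotr_le_maxnorm K V t y : convex_body K -> origin_symmetric K -> convex_body V ->
  V t -> polar K y -> `|dotr t y| <= maxnorm K V.
Proof.
move=> bK sK bV Vt yK; rewrite dotrC; apply: le_trans (body_norm_ub t bK sK yK) _.
have [L L0 LV] := body_bounded bV.
have [L' L'0 LK] := polar_bounded bK sK.
apply: ub_le_sup; last by exists t.
exists (L * (L' *+ m)) => _ [s sV <-]; apply: ge_sup.
  by exists `|dotr 0 s|, 0 => //; exact: polar0.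
move=> _ [u uK <-]; rewrite dotrC; apply: le_trans (dotr_bound u (LV s sV)) _.
rewrite ler_wpM2l ?(ltW L0) //.
apply: (@le_trans _ _ (\sum_(j < m) L')); first by apply: ler_sum => j _; exact: LK.
by rewrite sumr_const card_ord.
Qed.

(** A point of the polar at which a non-zero linear form is extremal cannot
    be interior, for it could be pushed outwards. *)
Lemma polar_maximizer_boundary K x y : convex_body K -> origin_symmetric K ->
  x != 0 -> polar K y -> `|dotr y x| = body_norm K x -> boundary (polar K) y.
Proof.
move=> bK sK x0 yK yx; split; first exact: subset_closure.
move=> yint; have /nbhs_rVP[r r0 rK] : nbhs y (polar K) := yint.
have n0 := body_norm_gt0 bK sK x0.
have [L L0 LK] := polar_bounded bK sK.
(* The dilation by 1 + e moves every coordinate of y by less than r. *)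
pose e := r / (2 * L).
have e0 : 0 < e by rewrite divr_gt0 // mulr_gt0.
have : polar K ((1 + e) *: y).
  apply: rK => j; rewrite mxE mulrDl mul1r opprD addrA subrr sub0r normrN normrM gtr0_norm //.
  apply: (@le_lt_trans _ _ (e * L)); first by rewrite ler_wpM2l ?LK // ltW.
  have -> : e * L = r / 2 by rewrite /e; field; rewrite gt_eqF.
  by rewrite ltr_pdivrMr // ltr_pMr // ltr1n.
move=> /(body_norm_ub x bK sK); rewrite dotrZl normrM yx ger0_norm ?addr_ge0 ?(ltW e0) //.
by rewrite mulrDl mul1r gerDl leNgt mulr_gt0.
Qed.

End ConvexBodies.

(** * Restriction to complex lines *)
Section Lines.
Context {R : realType} {m : nat}.
Implicit Types (t x y : 'rV[R]_m) (z X Y : 'rV[Cplx R]_m).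
Implicit Types (f : 'rV[Cplx R]_m -> Cplx R).

Definition toC x : 'rV[Cplx R]_m := map_mx (real_complex R) x.

Lemma toCE x j : toC x 0 j = ((x 0 j)%:C)%C.
Proof. by rewrite mxE. Qed.

Lemma has_cderiv_line f X Y (tau : Cplx R) : differentiable f (X + tau *: Y) ->
  has_cderiv (fun s => f (X + s *: Y)) tau ('d f (X + tau *: Y) Y).
Proof.
move=> fd; apply/has_cderivP.
have E : (fun h : Cplx R =>
    h^-1 *: (((fun s => f (X + s *: Y)) \o shift tau) (h *: 1) - f (X + tau *: Y)))
  = (fun h => h^-1 *: ((f \o shift (X + tau *: Y)) (h *: Y) - f (X + tau *: Y))).
  apply/funext => h /=; rewrite /shift /=; congr (_ *: (f _ - _)).
  by rewrite scalerDl [h *: 1]mulr1 [RHS]addrC -!addrA [tau *: _ + _]addrC.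
apply: DeriveDef.
- by rewrite /derivable E; exact: (diff_derivable fd).
- by rewrite /derive E; exact: (deriveE Y fd).
Qed.

(** The functional phi stands for the real or the imaginary part; the
    hypotheses on it are what both have in common. *)
Lemma derive_along_real (phi : Cplx R -> R) (G : Cplx R -> Cplx R) (d : Cplx R)
    (u : 'rV[R]_m -> R) x y :
  (forall w : Cplx R, `|phi w| <= modulus w) ->
  (forall (a b c : Cplx R) (h : R), phi (a - b - c * (h%:C)%C) = phi a - phi b - phi c * h) ->
  has_cderiv G 0 d -> (forall h : R, u (h *: y + x) = phi (G (h%:C)%C)) ->
  'D_y u x = phi d.
Proof.
move=> phile phiB Gd uG.
have ux : u x = phi (G 0) by rewrite -(uG 0) scale0r add0r.
have cv : h^-1 *: ((u \o shift x) (h *: y) - u x) @[h --> (0:R)^'] --> phi d.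
  apply/cvgrPdist_le => e e0.
  have [r r0 rP] := Gd _ e0.
  apply/nbhs_ballP; exists r => // h; rewrite /ball /= sub0r normrN => hr h0.
  have := rP (h%:C)%C; rewrite modulus_real add0r => /(_ hr) H.
  have {H} : `|phi (G (h%:C)%C - G 0 - d * (h%:C)%C)| <= e * `|h|.
    exact: le_trans (phile _) H.
  rewrite phiB -ler_pdivrMr ?normr_gt0 // -normrV ?unitfE // -normrM distrC.
  rewrite /shift /= uG ux.
  suff -> : (phi (G (h%:C)%C) - phi (G 0) - phi d * h) / h =
    h^-1 *: (phi (G (h%:C)%C) - phi (G 0)) - phi d by [].
  by rewrite /GRing.scale /= mulrBl mulfK // mulrC.
exact: cvg_lim cv.
Qed.

Lemma toC_line x y (h : R) : toC (h *: y + x) = toC x + (h%:C)%C *: toC y.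
Proof.
apply/rowP => j; rewrite toCE !mxE addrC.
by apply: complex_eq; rewrite !ReImE /= ?mulr0 ?mul0r; ring.
Qed.

Lemma restrE f x : restr f x = f (toC x).
Proof. by []. Qed.

Lemma partialE f x (j : 'I_m) : entire f ->
  partial (restr f) x j = 'd f (toC x) (toC (delta_mx 0 j)).
Proof.
move=> fe; set e := delta_mx 0 j.
have := @has_cderiv_line f (toC x) (toC e) 0; rewrite scale0r addr0 => /(_ (fe _)) H.
apply: complex_eq => /=.
- apply: derive_along_real H _; first exact: Re_le_modulus.
    by move=> a b c h; rewrite !ReImE /=; ring.
  by move=> h; rewrite restrE toC_line.
- apply: derive_along_real H _; first exact: Im_le_modulus.
    by move=> a b c h; rewrite !ReImE /=; ring.
  by move=> h; rewrite restrE toC_line.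
Qed.

Lemma grad_pairE f x y : entire f ->
  grad_pair (restr f) x y = 'd f (toC x) (toC y).
Proof.
move=> fe; rewrite /grad_pair (row_sum_delta (toC y)) linear_sum.
apply: eq_bigr => j _; rewrite partialE // linearZ /= toCE.
by rewrite /toC map_delta_mx.
Qed.

(** Since f is complex differentiable, its real partial derivatives are the
    values of its complex differential on the coordinate vectors, and the
    pairing of the gradient with y is the derivative along the complex line
    in direction y. *)
Lemma has_cderiv_grad_pair f x y : entire f ->
  has_cderiv (fun s => f (toC x + s *: toC y)) 0 (grad_pair (restr f) x y).
Proof.
move=> fe; rewrite grad_pairE //.
by have := @has_cderiv_line f (toC x) (toC y) 0; rewrite scale0r addr0; apply.
Qed.

Lemma dotc_toC t y : dotc t (toC y) = ((dotr t y)%:C)%C.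
Proof.
rewrite /dotc /dotr rmorph_sum; apply: eq_bigr => j _.
by rewrite toCE rmorphM.
Qed.

Lemma dotc_line t z X (tau : Cplx R) : dotc t (z + tau *: X) = dotc t z + tau * dotc t X.
Proof.
rewrite /dotc mulr_sumr -big_split; apply: eq_bigr => j _.
by rewrite !mxE mulrDr mulrCA.
Qed.

Lemma polar_norm_ub (V : set 'rV[R]_m) t z : convex_body V -> V t ->
  modulus (dotc t z) <= polar_norm V z.
Proof.
move=> bV Vt; have [L L0 LV] := body_bounded bV.
apply: ub_le_sup; last by exists t.
exists (L * \sum_j modulus (z 0 j)) => _ [s sV <-].
apply: (le_trans (modulus_sum _ _ _)); rewrite mulr_sumr; apply: ler_sum => j _.
by rewrite modulusM modulus_real ler_wpM2r ?modulus_ge0 // LV.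
Qed.

Lemma polar_norm_ge0 (V : set 'rV[R]_m) z : convex_body V -> 0 <= polar_norm V z.
Proof.
move=> bV; have [_ _ [t /interior_subset Vt]] := bV.
exact: le_trans (modulus_ge0 _) (polar_norm_ub z bV Vt).
Qed.

(** This supplies the exponential type of the restriction of f to a complex
    line: the first term is a constant there, and the growth is governed by
    M(K,V). *)
Lemma polar_norm_line (K V : set 'rV[R]_m) z y (tau : Cplx R) :
  convex_body K -> origin_symmetric K -> convex_body V -> polar K y ->
  polar_norm V (z + tau *: toC y) <= polar_norm V z + maxnorm K V * modulus tau.
Proof.
move=> bK sK bV yK; have [_ _ [t0 /interior_subset Vt0]] := bV.
apply: ge_sup; first by exists (modulus (dotc t0 (z + tau *: toC y))), t0.
move=> _ [t Vt <-]; rewrite dotc_line dotc_toC; apply: le_trans (modulusD _ _) _.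
apply: lerD; first exact: polar_norm_ub.
rewrite modulusM modulus_real mulrC ler_wpM2r ?modulus_ge0 //.
exact: dotr_le_maxnorm.
Qed.

Lemma supnorm_ub (F : 'rV[R]_m -> Cplx R) x : bounded_continuous F ->
  modulus (F x) <= supnorm F.
Proof. by move=> [_ bF]; apply: ub_le_sup => //; exists x. Qed.

Lemma le_of_le_add_eps (A B C : R) :
  (forall e, 0 < e -> A <= B + e * C) -> A <= B.
Proof.
move=> H; apply/ler_addgt0Pr => e e0.
have C0 : 0 < `|C| + 1 by rewrite ltr_wpDl.
apply: le_trans (H _ (divr_gt0 e0 C0)) _; rewrite lerD2l mulrAC ler_pdivrMr //.
by rewrite ler_wpM2l ?(ltW e0) // (le_trans (ler_norm _)) // lerDl.
Qed.

(** On the complex line through x in direction y the function has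
    exponential type (1 + e) M(K,V) for every e > 0. The inequality on the
    line is applied with this type, and e tends to 0 at the end. *)
Theorem bernstein_szego_bodies (K V : set 'rV[R]_m) f x y (alpha : R) :
  convex_body K -> origin_symmetric K -> convex_body V -> 0 < maxnorm K V ->
  exp_type V f -> bounded_continuous (restr f) -> polar K y ->
  BS_lhs K V (restr f) x y alpha <= maxnorm K V * supnorm (restr f).
Proof.
move=> bK sK bV M0 [fe fgrowth] bf yK; rewrite /BS_lhs.
set M := maxnorm K V in M0 *; set S := supnorm _.
pose g s := f (toC x + s *: toC y).
have gd s : differentiable g s.
  exact: has_cderiv_diff (has_cderiv_line (fe _)).
have gS (s : R) : modulus (g (s%:C)%C) <= S.
  by rewrite /g -toC_line; exact: (supnorm_ub (s *: y + x) bf).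
have g0E : restr f x = g 0 by rewrite /g scale0r addr0 restrE.
have gg1 : has_cderiv g 0 (grad_pair (restr f) x y) := has_cderiv_grad_pair x y fe.
set g1 := grad_pair _ _ _ in gg1 *.
have key e : 0 < e ->
  modulus (((sin alpha)%:C)%C * g1 - (((1 + e) * M * cos alpha)%:C)%C * g 0) <= (1 + e) * M * S.
  move=> e0; have e1 : 0 < 1 + e by rewrite addr_gt0.
  have [C0 C00 fC] := fgrowth e e0.
  apply: (@bernstein_szego_line _ g (C0 * expR ((1 + e) * polar_norm V (toC x)))) => //.
    exact: mulr_gt0.
  move=> s; apply: le_trans (fC _) _; rewrite -mulrA -expRD.
  rewrite ler_wpM2l ?(ltW C00) // ler_expR -[(1 + e) * M * _]mulrA -mulrDr.
  by rewrite ler_wpM2l ?(ltW e1) // polar_norm_line.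
rewrite g0E; apply: (@le_of_le_add_eps _ _ (M * S + M * modulus (g 0))) => e e0.
have -> : ((sin alpha)%:C)%C * g1 - ((M * cos alpha)%:C)%C * g 0 =
  (((sin alpha)%:C)%C * g1 - (((1 + e) * M * cos alpha)%:C)%C * g 0) +
  ((e * M * cos alpha)%:C)%C * g 0.
  by apply: complex_eq; rewrite !ReImE /=; ring.
apply: le_trans (modulusD _ _) _.
have : modulus (((e * M * cos alpha)%:C)%C * g 0) <= e * (M * modulus (g 0)).
  rewrite modulusM modulus_real mulrA ler_wpM2r ?modulus_ge0 //.
  rewrite normrM (gtr0_norm (mulr_gt0 e0 M0)) ler_piMr //; first by rewrite ltW // mulr_gt0.
  by rewrite ler_norml cos_geN1 cos_le1.
have := key e e0; lra.
Qed.

End Lines.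

(** * The extremal functions *)
Section Extremal.
Context {R : realType} {m : nat}.
Implicit Types (t x y : 'rV[R]_m) (z : 'rV[Cplx R]_m).

(** The extremal function in the single variable on which it depends. *)
Definition exp_pair (C1 C2 : Cplx R) (tau : Cplx R) : Cplx R :=
  C1 * cexp (Complex 0 1 * tau) + C2 * cexp (- (Complex 0 1) * tau).

Lemma extremalE (a : 'rV[R]_m) (C1 C2 : Cplx R) z :
  extremal a C1 C2 z = exp_pair C1 C2 (dotc a z).
Proof. by rewrite /extremal /exp_pair mulNr. Qed.

Lemma has_cderiv_exp_pair (C1 C2 : Cplx R) :
  has_cderiv (exp_pair C1 C2) 0 (Complex 0 1 * (C1 - C2)).
Proof.
have -> : Complex 0 1 * (C1 - C2) =
    C1 * (Complex 0 1 * cexp (Complex 0 1 * 0)) +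
    C2 * (- Complex 0 1 * cexp (- Complex 0 1 * 0)) :> Cplx R.
  by rewrite !mulr0 cexp0; ring.
by apply: has_cderivD; apply: has_cderivMl; exact: has_cderiv_cexpZ.
Qed.

Lemma differentiable_exp_pair (C1 C2 : Cplx R) tau : differentiable (exp_pair C1 C2) tau.
Proof.
by apply: has_cderiv_diff; apply: has_cderivD; apply: has_cderivMl; exact: has_cderiv_cexpZ.
Qed.

Lemma modulus_exp_pair (C1 C2 : Cplx R) tau :
  modulus (exp_pair C1 C2 tau) <= (modulus C1 + modulus C2) * expR `|complex.Im tau|.
Proof.
apply: le_trans (modulusD _ _) _; rewrite !modulusM !modulus_cexp mulrDl.
have -> : complex.Re (Complex 0 1 * tau) = - complex.Im tau.
  by rewrite cReM /=; ring.
have -> : complex.Re (- Complex 0 1 * tau) = complex.Im tau.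
  by rewrite cReM /=; ring.
apply: lerD; rewrite ler_wpM2l ?modulus_ge0 // ler_expR ?ler_norm //.
by rewrite -normrN ler_norm.
Qed.

Lemma extremal_entire (a : 'rV[R]_m) (C1 C2 : Cplx R) : entire (extremal a C1 C2).
Proof.
move=> z; rewrite (_ : extremal a C1 C2 = exp_pair C1 C2 \o dotc a); last first.
  by apply/funext => w; rewrite extremalE.
apply: differentiable_comp; last exact: differentiable_exp_pair.
exact: differentiable_linear_form.
Qed.

Lemma extremal_exp_type (V : set 'rV[R]_m) (a : 'rV[R]_m) (C1 C2 : Cplx R) :
  convex_body V -> V a -> exp_type V (extremal a C1 C2).
Proof.
move=> bV Va; split; first exact: extremal_entire.
move=> e e0; have k0 : 0 <= modulus C1 + modulus C2 by rewrite addr_ge0 ?modulus_ge0.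
exists (modulus C1 + modulus C2 + 1); first by rewrite ltr_wpDl.
move=> z; rewrite extremalE; apply: le_trans (modulus_exp_pair _ _ _) _.
apply: ler_pM; rewrite ?expR_ge0 // ?lerDl // ler_expR.
apply: le_trans (Im_le_modulus _) _; apply: le_trans (polar_norm_ub z bV Va) _.
by rewrite ler_peMl ?polar_norm_ge0 // lerDl ltW.
Qed.

Lemma restr_extremalE (a : 'rV[R]_m) (C1 C2 : Cplx R) x :
  restr (extremal a C1 C2) x = exp_pair C1 C2 ((dotr a x)%:C)%C.
Proof. by rewrite restrE extremalE dotc_toC. Qed.

Lemma real_complex_continuous : continuous (fun a : R => (a%:C)%C : Cplx R).
Proof.
move=> x; apply/(@cvgrPdist_le _ _ _ (nbhs x)) => e /gt0_CplxP[-> e0].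
apply/nbhs_ballP; exists (complex.Re e) => // y /ltW xy.
rewrite modulusE Cplx_leE.
have -> : (x%:C)%C - (y%:C)%C = ((x - y)%:C)%C :> Cplx R by rewrite rmorphB.
by rewrite modulus_real.
Qed.

Lemma extremal_bounded_continuous (a : 'rV[R]_m) (C1 C2 : Cplx R) :
  bounded_continuous (restr (extremal a C1 C2)).
Proof.
split.
  rewrite (_ : restr _ =
      exp_pair C1 C2 \o ((fun b : R => (b%:C)%C : Cplx R) \o dotr a)); last first.
    by apply/funext => x; rewrite restr_extremalE.
  move=> x; apply: continuous_comp.
    by apply: continuous_comp; [exact: dotr_continuous|exact: real_complex_continuous].
  exact: differentiable_continuous (differentiable_exp_pair _ _ _).
exists (modulus C1 + modulus C2) => _ [x _ <-]; rewrite restr_extremalE.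
by apply: le_trans (modulus_exp_pair _ _ _) _; rewrite /= normr0 expR0 mulr1.
Qed.

Lemma grad_pair_extremal (a : 'rV[R]_m) (C1 C2 : Cplx R) y :
  grad_pair (restr (extremal a C1 C2)) 0 y =
  ((dotr a y)%:C)%C * (Complex 0 1 * (C1 - C2)).
Proof.
have H1 := has_cderiv_grad_pair 0 y (extremal_entire a C1 C2).
apply: has_cderiv_unique H1 _.
set c : Cplx R := ((dotr a y)%:C)%C.
have := @has_cderiv_affine _ (exp_pair C1 C2) 0 0 c (Complex 0 1 * (C1 - C2)).
rewrite mulr0 addr0 => /(_ (has_cderiv_exp_pair _ _)).
suff -> : (fun w => exp_pair C1 C2 (0 + c * w)) =
  (fun s => extremal a C1 C2 (toC 0 + s *: toC y)) by [].
apply/funext => s; rewrite extremalE dotc_line !dotc_toC dotr0 mulrC.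
by congr (exp_pair _ _ (_ + _)); apply: complex_eq.
Qed.

(** The square of the modulus at th is |C1|^2 + |C2|^2 + 2 Re (C1 conj C2
    exp(2 i th)). A bound by |C1|^2 + |C2|^2 at all th makes the last term
    non-positive for every phase, and the four phases 0, pi and +-pi/2
    suffice to conclude that C1 conj C2 = 0. So the norm condition on the
    extremal functions leaves only a single exponential. *)
Lemma exp_pair_cross_term (C1 C2 : Cplx R) (N : R) :
  (forall th : R, modulus (exp_pair C1 C2 ((th%:C)%C)) <= N) ->
  N ^+ 2 = modulus C1 ^+ 2 + modulus C2 ^+ 2 -> C1 = 0 \/ C2 = 0.
Proof.
move=> HN N2; pose D := C1 * cconj C2.
have key b : complex.Re (D * Complex (cos b) (sin b)) <= 0.
  have N0 : 0 <= N := le_trans (modulus_ge0 _) (HN 0).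
  have := HN (b / 2); rewrite -(ler_pXn2r (n := 2)) ?nnegrE ?modulus_ge0 // N2.
  have -> : exp_pair C1 C2 (((b / 2)%:C)%C) =
      C1 * Complex (cos (b / 2)) (sin (b / 2)) + C2 * Complex (cos (b / 2)) (- sin (b / 2)).
    have cis (th : R) : cexp (Complex 0 th) = Complex (cos th) (sin th).
      by rewrite /cexp expR0 !mul1r.
    rewrite /exp_pair -sinN -[in Complex _ (sin (- _))]cosN -!cis.
    by congr (_ * cexp _ + _ * cexp _); apply: complex_eq; rewrite !ReImE /=; ring.
  have cb : cos b = cos (b / 2) ^+ 2 - sin (b / 2) ^+ 2.
    by rewrite {1}(splitr b) cosD !expr2.
  have sb : sin b = 2 * (cos (b / 2) * sin (b / 2)).
    by rewrite {1}(splitr b) sinD; ring.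
  have cs := cos2Dsin2 (b / 2).
  move: (cos (b / 2)) (sin (b / 2)) cb sb cs => c s cb sb cs.
  rewrite !modulus_sqr cb sb /D; case: (C1) => p1 p2; case: (C2) => q1 q2 /= H.
  suff : (p1 ^+ 2 + p2 ^+ 2 + (q1 ^+ 2 + q2 ^+ 2)) * (c ^+ 2 + s ^+ 2) +
     2 * ((p1 * q1 - p2 * - q2) * (c ^+ 2 - s ^+ 2) - (p1 * - q2 + p2 * q1) * (2 * (c * s)))
     <= (p1 ^+ 2 + p2 ^+ 2 + (q1 ^+ 2 + q2 ^+ 2)).
    by rewrite cs mulr1; lra.
  apply: le_trans H; rewrite le_eqVlt; apply/orP; left; apply/eqP; ring.
have D0 : D = 0.
  have := key 0; have := key pi; have := key (pi / 2); have := key (- (pi / 2)).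
  rewrite cosN sinN cos_pihalf sin_pihalf cospi sinpi cos0 sin0.
  case: (D) => d1 d2; rewrite !cReM /= => h1 h2 h3 h4.
  by apply: complex_eq => /=; lra.
move/eqP: D0; rewrite mulf_eq0 => /orP[/eqP ->|]; first by left.
by rewrite -modulus_eq0 modulusJ modulus_eq0 => /eqP ->; right.
Qed.

Lemma modulus_sin_cos (b M s c : R) : `|b| = M -> s ^+ 2 + c ^+ 2 = 1 ->
  modulus (Complex (- (M * c)) (b * s)) = M.
Proof.
move=> bM sc.
have M0 : 0 <= M by rewrite -bM.
rewrite /modulus /= sqrrN !exprMn -[b ^+ 2]real_normK ?num_real // bM.
by rewrite -mulrDr addrC sc mulr1 sqrtr_sqr ger0_norm.
Qed.

(** For a single exponential at the origin the left-hand side is the modulus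
    of the coefficient times that of M cos alpha +- i b sin alpha, with b =
    (a,y) and |b| = M. *)
Lemma BS_lhs_extremal (K V : set 'rV[R]_m) (a y : 'rV[R]_m) (C1 C2 : Cplx R) (alpha : R) :
  `|dotr a y| = maxnorm K V -> C1 = 0 \/ C2 = 0 ->
  BS_lhs K V (restr (extremal a C1 C2)) 0 y alpha =
  maxnorm K V * Num.sqrt (modulus C1 ^+ 2 + modulus C2 ^+ 2).
Proof.
move=> ay C12; rewrite /BS_lhs grad_pair_extremal restr_extremalE dotr0.
set M := maxnorm K V in ay *; set b := dotr a y in ay *.
have -> : exp_pair C1 C2 ((0%:C)%C) = C1 + C2.
  by rewrite /exp_pair !mulr0 cexp0 !mulr1.
have sc : sin alpha ^+ 2 + cos alpha ^+ 2 = 1 by rewrite addrC cos2Dsin2.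
have scN : (- sin alpha) ^+ 2 + cos alpha ^+ 2 = 1 by rewrite sqrrN.
case: C12 => ->.
  rewrite modulus0 expr0n !add0r sqrtr_sqr ger0_norm ?modulus_ge0 //.
  rewrite -{2}(modulus_sin_cos ay scN) -modulusM; congr modulus.
  by case: C2 => c1 c2; apply: complex_eq; rewrite !ReImE /=; ring.
rewrite modulus0 expr0n !addr0 subr0 sqrtr_sqr ger0_norm ?modulus_ge0 //.
rewrite -{2}(modulus_sin_cos ay sc) -modulusM; congr modulus.
by case: C1 => c1 c2; apply: complex_eq; rewrite !ReImE /=; ring.
Qed.

Lemma supnorm_extremal_single (a : 'rV[R]_m) : supnorm (restr (extremal a 1 0)) = 1.
Proof.
have E x : modulus (restr (extremal a 1 0) x) = 1.
  rewrite restr_extremalE /exp_pair mul0r addr0 mul1r modulus_cexp cReM /=.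
  by rewrite mul0r mulr0 subrr expR0.
rewrite /supnorm; under eq_fun do rewrite E.
rewrite (_ : _ @` _ = [set 1]) ?sup1 //.
by apply/seteqP; split=> [_ [x _ <-]//|_ ->]; exists 0.
Qed.

End Extremal.

Theorem theorem2p1 (R : realType) (m : nat) (K V : set 'rV[R]_m) (a : 'rV[R]_m)
    (K_body : convex_body K) (K_sym : origin_symmetric K)
    (V_body : convex_body V) (V_sym : origin_symmetric V)
    (a_bd : boundary V a) (a_max : body_norm K a = maxnorm K V) :
  [/\
    (* the inequality *)
    forall (f : 'rV[Cplx R]_m -> Cplx R) (x y : 'rV[R]_m) (alpha : R),
      exp_type V f -> bounded_continuous (restr f) ->
      boundary (polar K) y -> 0 <= alpha < pi *+ 2 ->
      BS_lhs K V (restr f) x y alpha <= maxnorm K V * supnorm (restr f),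
    (* the functions f_0 belong to the class *)
    forall C1 C2 : Cplx R,
      exp_type V (extremal a C1 C2) /\
      bounded_continuous (restr (extremal a C1 C2)),
    (* equality *)
    exists x0 y0 : 'rV[R]_m, boundary (polar K) y0 /\
      forall (alpha : R) (C1 C2 : Cplx R), 0 <= alpha < pi *+ 2 ->
        supnorm (restr (extremal a C1 C2))
          = Num.sqrt (modulus C1 ^+ 2 + modulus C2 ^+ 2) ->
        BS_lhs K V (restr (extremal a C1 C2)) x0 y0 alpha
          = maxnorm K V * supnorm (restr (extremal a C1 C2))
  & (* sharpness *)
    forall alpha : R, 0 <= alpha < pi *+ 2 ->
      exists (f : 'rV[Cplx R]_m -> Cplx R) (x y : 'rV[R]_m),
        [/\ exp_type V f, bounded_continuous (restr f),
            0 < supnorm (restr f), boundary (polar K) y &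
            BS_lhs K V (restr f) x y alpha = maxnorm K V * supnorm (restr f)]].
Proof.
have [a_cl a_int] := a_bd.
have Va : V a by exact: body_closed.
have a0 : a != 0 by apply: contra_notN a_int => /eqP ->; exact: body_nbhs0.
have M0 : 0 < maxnorm K V by rewrite -a_max body_norm_gt0.
have [y0 y0K y0a] := body_norm_attained a K_body K_sym.
have y0_bd := polar_maximizer_boundary K_body K_sym a0 y0K y0a.
have ay0 : `|dotr a y0| = maxnorm K V by rewrite dotrC y0a.
split.
- move=> f x y alpha ftype fbd [y_cl _] _.
  by apply: bernstein_szego_bodies => //; exact: polar_closed.
- by move=> C1 C2; split; [exact: extremal_exp_type|exact: extremal_bounded_continuous].
- exists 0, y0; split=> // alpha C1 C2 _ sup12; rewrite sup12.
  apply: BS_lhs_extremal => //.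
  apply: (@exp_pair_cross_term _ _ _ (supnorm (restr (extremal a C1 C2)))).
    move=> th; have aa := dotr_self_gt0 a0.
    have -> : th = dotr a ((th / dotr a a) *: a) by rewrite dotrZr divfK // gt_eqF.
    rewrite -restr_extremalE; apply: supnorm_ub; exact: extremal_bounded_continuous.
  by rewrite sup12 sqr_sqrtr // addr_ge0 ?sqr_ge0.
- move=> alpha _; exists (extremal a 1 0), 0, y0; split.
  + exact: extremal_exp_type.
  + exact: extremal_bounded_continuous.
  + by rewrite supnorm_extremal_single.
  + exact: y0_bd.
  + rewrite supnorm_extremal_single BS_lhs_extremal //; last by right.
    by rewrite modulus1 modulus0 expr0n expr1n addr0 sqrtr1.
Qed.
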